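(* Let $a,b,c,d,\theta_1,\theta_2$ be fixed and satisfy $$0<a,b,c,d,\theta_1,\theta_2<1,\qquad \theta_1<\theta_2,\qquad b+d<1.$$ Put $r=\frac{1-\theta_2}{1-\theta_1}$, $$(q,\alpha,\beta,\gamma,\delta)=\left(\frac{\theta_1}{\theta_2},\ \frac{(1-\theta_1)a}{\theta_2},\ \frac{(1-\theta_2)b}{\theta_2(1-b-d)},\ \frac{(1-\theta_2)c}{\theta_2},\ \frac{(1-\theta_1)d}{\theta_2(1-b-d)}\right),$$ and $$A=\kappa_+(\beta,\delta),\quad B=\kappa_-(\beta,\delta),\quad C=\kappa_+(\alpha,\gamma),\quad D=\kappa_-(\alpha,\gamma),$$ $$\kappa_\pm(u,v)=\frac{1}{2u}\left(1-q-u+v\pm\sqrt{(1-q-u+v)^2+4uv}\right).$$ For each $N$, let $\mu=\mu_N$ be the stationary measure of the six-vertex model on the strip of width $N$ with these parameters on a horizontal path, and let $\rho=\frac1N\sum_{i=1}^N\tau_i$. Assume $AC<1$ and the technical condition $$|A\sqrt r|,\ |B\sqrt r|,\ |C/\sqrt r|,\ |D/\sqrt r|\ \ne\ q^{-l}\quad\text{for all } l=0,1,2,\dots$$ Then $$\lim_{N\to\infty}\mathbb E_\mu\rho=\begin{cases}\dfrac{\sqrt r}{1+\sqrt r}, & A\le 1/\sqrt r,\ C\le\sqrt r,\\[2mm] \dfrac{Ar}{1+Ar}, & A>1/\sqrt r,\ AC<1,\\[2mm] \dfrac{r}{r+C}, & C>\sqrt r,\ AC<1.\end{cases}$$ Moreover,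 if in addition $a+c<1$, the same conclusion holds (for $AC<1$) without assuming the technical condition.
   Context: Strip and paths. Fix an integer $N\ge 1$. The strip of width $N$ is $\{(x,y)\in\mathbb Z^2: 0\le y\le x\le y+N\}$, with an edge between any two of its vertices at distance 1; each edge can carry at most one (up or right) arrow. Vertices $(y,y)$ are left boundary vertices, $(y+N,y)$ are right boundary vertices, all others are bulk vertices. The left/bottom edges at a vertex (those lying in the strip) are its incoming edges, the right/top ones its outgoing edges. Thus a left boundary vertex has at most a bottom incoming edge and a right outgoing edge; a right boundary vertex has a left incoming edge and a top outgoing edge. A down-right path $\mathcal P$ is a path in the strip from a left boundary vertex to a right boundary vertex with each step going down or right by 1 (so it has $N$ steps). Its outgoing edges are the edges going up or right from a vertex of $\mathcal P$ to a vertex not on $\mathcal P$; there are exactly $N$, labelled $p_1,\dots,p_N$ from up-left to down-right ($p_i$ is the unique one joining the lines $x-y=i-1$ and $x-y=i$). An outgoing configuration of $\mathcal P$ is $\tau=(\tau_1,\dots,\tau_N)\in\{0,1\}^N$, $\tau_i=1$ iff $p_i$ carries an arrow. A path is horizontal if it is $(y,y),(y+1,y),\dots,(y+N,y)$. Six-vertex dynamics. Let $\mathcal Q$ be a down-right path lying (weakly) above $\mathcal P$. Given an outgoing configuration of $\mathcal P$, sample sequentially the outgoing edges of all vertices between $\mathcal P$ and $\mathcal Q$, including those on $\mathcal Q$ and excluding those on $\mathcal P$, in order of increasing $y$ and, for equal $y$, increasing $x$, independently given the incoming edges, as follows. Bulk vertex: if both (resp. neither) incoming edges carry arrows, both (resp.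 neither) outgoing edges do; if only the left incoming edge carries an arrow, it exits to the right with probability $\theta_2$ and to the top with probability $1-\theta_2$; if only the bottom incoming edge carries an arrow, it exits to the top with probability $\theta_1$ and to the right with probability $1-\theta_1$. Left boundary vertex: if the bottom edge carries an arrow, the right edge carries one with probability $1-c$ (none with probability $c$); if the bottom edge is empty, the right edge carries an arrow with probability $a$ (none with probability $1-a$). Right boundary vertex: if the left edge carries an arrow, the top edge carries one with probability $1-b$ (none with probability $b$); if the left edge is empty, the top edge carries an arrow with probability $d$ (none with probability $1-d$). This defines a transition matrix $P_{\mathcal P,\mathcal Q}(\tau,\tau')$ from outgoing configurations of $\mathcal P$ to those of $\mathcal Q$. Particle system on $\mathcal P$. Let $\mathcal P_k=\mathcal P+(k,k)$. The interacting particle system of the six-vertex model on the strip on $\mathcal P$ is the time-homogeneous Markov chain on $\{0,1\}^N$ with transition matrix $P_{\mathcal P_k,\mathcal P_{k+1}}=P_{\mathcal P,\mathcal P_1}$. Its stationary measure is called the stationary measure of the six-vertex model on a strip on $\mathcal P$. For $a,b,c,d,\theta_1,\theta_2\in(0,1)$ this chain is irreducible, so the stationary measure is unique. *)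

(* Defs.v *)
From mathcomp Require Import all_boot all_order all_algebra.
From mathcomp Require Import all_classical all_reals all_analysis.

Set Implicit Arguments.
Unset Strict Implicit.
Unset Printing Implicit Defensive.

Import Order.TTheory GRing.Theory Num.Theory.
Import numFieldNormedType.Exports.

Local Open Scope ring_scope.

(* The strip lies in the quadrant 0 <= y <= x, so natural coordinates are
   enough. *)
Definition vertex : Type := (nat * nat)%type.

Definition strip (N : nat) : pred vertex :=
  [pred v : vertex | v.2 <= v.1 <= v.2 + N]%N.

Definition is_left_boundary (v : vertex) : bool := v.1 == v.2.

Definition is_right_boundary (N : nat) (v : vertex) : bool :=
  v.1 == (v.2 + N)%N.

(* An edge is the pair of its endpoints, the lower or left one first. *)
Definition edge : Type := (vertex * vertex)%type.

Definition right_edge (v : vertex) : edge := (v, (v.1.+1, v.2)).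
Definition top_edge (v : vertex) : edge := (v, (v.1, v.2.+1)).
Definition left_edge (v : vertex) : edge := ((v.1.-1, v.2), v).
Definition bottom_edge (v : vertex) : edge := ((v.1, v.2.-1), v).

(* [s e] tells whether the edge [e] carries an arrow. *)
Definition config : Type := edge -> bool.

Definition down_right_step (u v : vertex) : bool :=
  (v == (u.1.+1, u.2)) || (u == (v.1, v.2.+1)).

Definition down_right_path (N : nat) (P : seq vertex) : bool :=
  if P is u :: P' then
    [&& path down_right_step u P', all (mem (strip N)) P,
        is_left_boundary u & is_right_boundary N (last u P')]
  else false.

Definition horizontal_path (N y : nat) : seq vertex :=
  [seq ((y + i)%N, y) | i <- iota 0 N.+1].

Definition shift_path (k : nat) (P : seq vertex) : seq vertex :=
  [seq ((v.1 + k)%N, (v.2 + k)%N) | v <- P].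

(* The k-th vertex of a down-right path lies on the line x - y = k.  Its
   outgoing top edge joins that line to x - y = k - 1 and its outgoing right
   edge joins it to x - y = k + 1, so this list is p_1, ..., p_N in order. *)
Definition outgoing_edges (N : nat) (P : seq vertex) : seq edge :=
  [seq e <- flatten [seq [:: top_edge u; right_edge u] | u <- P]
     | (e.2 \in strip N) && (e.2 \notin P)].

Definition strictly_above (P : seq vertex) (v : vertex) : bool :=
  has (fun u : vertex => (u.1 - u.2 == v.1 - v.2) && (u.2 < v.2))%N P.

(* The vertices above P and weakly below Q, by increasing y, then increasing x.
   The first vertex of a down-right path is its highest one. *)
Definition vertices_between (N : nat) (P Q : seq vertex) : seq vertex :=
  [seq v <- [seq (x, y) | y <- iota 0 (head (0%N, 0%N) Q).2.+1,
                          x <- iota y N.+1]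
     | strictly_above P v && ~~ strictly_above Q v].

Lemma horizontal_path_down_right (N y : nat) :
  down_right_path N (horizontal_path N y).
Proof.
have hp m n : path down_right_step ((y + m)%N, y)
                [seq ((y + i)%N, y) | i <- iota m.+1 n].
  by elim: n m => //= n IH m; rewrite IH /down_right_step addnS eqxx.
have hl m n : last ((y + m)%N, y) [seq ((y + i)%N, y) | i <- iota m.+1 n]
              = ((y + (m + n))%N, y).
  by elim: n m => [|n IH] m /=; rewrite ?addn0 // IH addSnnS.
have := hp 0%N N; have := hl 0%N N.
rewrite /down_right_path /horizontal_path /= addn0 add0n => -> ->.
rewrite /is_left_boundary /is_right_boundary /= !eqxx !andbT.
rewrite inE /= leqnn leq_addr /=; apply/allP => v /mapP[i].
rewrite mem_iota => /andP[_ iN] ->.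
by apply/andP; split; [exact: leq_addr | rewrite leq_add2l; move: iN].
Qed.

Record params (R : Type) := Params {
  par_a : R; par_b : R; par_c : R; par_d : R; theta1 : R; theta2 : R }.

Section SixVertex.
Context {R : realFieldType}.
Implicit Type p : params R.

Definition coin_weight (x : R) (o : bool) : R := if o then x else 1 - x.

(* [vertex_weight p N v l b t r] is the probability that the top and right
   edges of [v] are in states [t] and [r], given the states [l] and [b] of its
   left and bottom edges.  Edges leaving the strip never carry an arrow. *)
Definition vertex_weight p (N : nat) (v : vertex) (l b t r : bool) : R :=
  if is_left_boundary v then
    (~~ t)%:R * coin_weight (if b then 1 - par_c p else par_a p) r
  else if is_right_boundary N v then
    (~~ r)%:R * coin_weight (if l then 1 - par_b p else par_d p) t
  else match l, b with
    | true, true => (t && r)%:R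
    | false, false => (~~ t && ~~ r)%:R
    | true, false => (t != r)%:R * coin_weight (theta2 p) r
    | false, true => (t != r)%:R * coin_weight (theta1 p) t
    end.

(* Expectation of [f] of the configuration obtained from [s] by sampling the
   outgoing edges of the vertices of [vs] one after the other. *)
Fixpoint sample p (N : nat) (vs : seq vertex) (f : config -> R) (s : config)
    : R :=
  if vs is v :: vs' then
    \sum_(t : bool) \sum_(r : bool)
      vertex_weight p N v (s (left_edge v)) (s (bottom_edge v)) t r
      * sample p N vs' f [eta s with top_edge v |-> t, right_edge v |-> r]
  else f s.

Definition init_config (N : nat) (P : seq vertex) (tau : N.-tuple bool)
    : config :=
  fun e => nth false tau (index e (outgoing_edges N P)).

Definition outgoing_config (N : nat) (P : seq vertex) (s : config)
    : seq bool :=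
  [seq s e | e <- outgoing_edges N P].

Definition transition p (N : nat) (P Q : seq vertex)
    (tau tau' : N.-tuple bool) : R :=
  sample p N (vertices_between N P Q)
    (fun s => (outgoing_config N Q s == tau')%:R) (init_config P tau).

Definition is_distribution (T : finType) (mu : T -> R) : Prop :=
  (forall x, 0 <= mu x) /\ \sum_x mu x = 1.

Definition stationary_measure p (N : nat) (P : seq vertex)
    (mu : N.-tuple bool -> R) : Prop :=
  is_distribution mu /\
  forall tau',
    \sum_tau mu tau * transition p P (shift_path 1 P) tau tau' = mu tau'.

Definition mean_density (N : nat) (tau : N.-tuple bool) : R :=
  N%:R^-1 * \sum_(i < N) (tnth tau i)%:R.

Definition finite_mean (T : finType) (mu : T -> R) (f : T -> R) : R :=
  \sum_x mu x * f x.

End SixVertex.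

Section PhaseDiagram.
Context {R : realType}.
Implicit Type p : params R.

Definition par_q p : R := theta1 p / theta2 p.

Definition par_r p : R := (1 - theta2 p) / (1 - theta1 p).

Definition par_alpha p : R := (1 - theta1 p) * par_a p / theta2 p.

Definition par_beta p : R :=
  (1 - theta2 p) * par_b p / (theta2 p * (1 - par_b p - par_d p)).

Definition par_gamma p : R := (1 - theta2 p) * par_c p / theta2 p.

Definition par_delta p : R :=
  (1 - theta1 p) * par_d p / (theta2 p * (1 - par_b p - par_d p)).

Definition kappa_plus (q u v : R) : R :=
  (2 * u)^-1 *
  (1 - q - u + v + Num.sqrt ((1 - q - u + v) ^+ 2 + 4 * u * v)).

Definition kappa_minus (q u v : R) : R :=
  (2 * u)^-1 *
  (1 - q - u + v - Num.sqrt ((1 - q - u + v) ^+ 2 + 4 * u * v)).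

Definition par_A p : R := kappa_plus (par_q p) (par_beta p) (par_delta p).
Definition par_B p : R := kappa_minus (par_q p) (par_beta p) (par_delta p).
Definition par_C p : R := kappa_plus (par_q p) (par_alpha p) (par_gamma p).
Definition par_D p : R := kappa_minus (par_q p) (par_alpha p) (par_gamma p).

Definition technical_condition p : Prop :=
  let s := Num.sqrt (par_r p) in
  forall l : nat,
    [/\ `|par_A p * s| != par_q p ^- l, `|par_B p * s| != par_q p ^- l,
        `|par_C p / s| != par_q p ^- l & `|par_D p / s| != par_q p ^- l].

Local Open Scope classical_set_scope.

Definition phase_limit p (u : R ^nat) : Prop :=
  let r := par_r p in
  let s := Num.sqrt r in
  let A := par_A p in
  let C := par_C p in
  [/\ A <= s^-1 /\ C <= s -> u @ \oo --> s / (1 + s),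
      A > s^-1 /\ A * C < 1 -> u @ \oo --> A * r / (1 + A * r)
    & C > s /\ A * C < 1 -> u @ \oo --> r / (r + C)].

End PhaseDiagram.

(* Main.v *)
Require Import Defs.
From HB Require Import structures.
From mathcomp Require Import all_boot all_order all_algebra.
From mathcomp Require Import all_classical all_reals all_analysis.
From mathcomp Require Import ring lra zify.

Set Implicit Arguments.
Unset Strict Implicit.
Unset Printing Implicit Defensive.

Import Order.TTheory GRing.Theory Num.Theory.
Import numFieldNormedType.Exports.

Local Open Scope ring_scope.

(** Why the theorem is true.

    The stationary measure on a horizontal path is explicit: [mu tau] is
    proportional to [r ^ |tau| * Phi tau], where [Phi] is a family of weights on
    finite binary words with the matrix product relations of the open ASEP,
      DE - q ED = D + E,  <W|(alpha E - gamma D) = <W|,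
      (beta D - delta E)|V> = |V>,
    D standing for an occupied site and E for an empty one.  Put [k r D], [k E]
    on the vertical edges, with [k = (1 - theta1) / theta2], and [k r D + 1],
    [k E - 1] on the horizontal ones.  Then every vertex turns the product of
    the operators on its incoming edges into the product on its outgoing edges,
    and a whole row of vertices can be pushed through a word
    ([word_mean_ansatz]).  The stationary measure is unique because particles
    can be lost until the system is empty ([stationary_measure_ansatz]).

    The relations at <W| and in the bulk let words act on polynomials: D is
    multiplication by ['X] and E is the operator [hole].  The relation at |V>
    then becomes a recursion for the moments of a linear functional [phi].  It
    can be solved when [gamma * delta < alpha * beta], which follows from
    [A * C < 1] ([fan_region]), and all its coefficients are nonnegative, so
    [phi] is nonnegative on polynomials with nonnegative coefficients
    ([ansatz_functional_exists]).

    Let [Z N y = \sum_w y ^ |w| * Phi w = phi (H^N 1)] with [H = E + y D].  The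
    exponential moment of the number of particles under [mu N] is
    [Z N (r e^h) / Z N r].  By convexity, an exponential upper bound for
    [Z N y] at all [y] and a matching lower bound at [y = r] determine the limit
    of the density ([density_limit]).

    - Upper bound.  For each [v] with [C <= v <= 1 / A] the evaluation at
      a suitable point dominates [phi] and grows under [H] by at most
      [growth v y = (1 + v) * (1 + y / v) / (1 - q)]; hence
      [Z N y <= growth v y ^ N] ([partition_fun_upper]).  This evaluation is the
      product measure of odds [1 / v].

    - Lower bound.  One has [f.[0] <= phi f], and in the basis of q-falling
      factorials [H] is a nonnegative tridiagonal matrix, so it suffices to find
      finitely supported sub-eigenvectors ([tridiagonal_growth]).  For [v = C]
      the evaluation above is an exact eigenvector, and if [r < C ^ 2] its
      associated birth-and-death chain drifts to the left, so that a linear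
      cutoff works ([low_density_lower_bound]).  For [v = sqrt r] a parabola
      does ([max_current_lower_bound]).

    - Particle-hole symmetry exchanges A and C, and [r] with its inverse; it
      reduces the case [v = 1 / A] to [v = C] ([growth_weights_reverse]).

    The limit is [r / (v + r)], where [v] is the point between [C] and
    [1 / A] closest to [sqrt r]; the three positions of [sqrt r] are the three phases. *)

(** * Linear maps on polynomials *)

Section LinearExtension.
Context {R : realFieldType} {V : lmodType R}.

Definition extend_linear (e : nat -> V) (f : {poly R}) : V :=
  \sum_(i < size f) f`_i *: e i.

Lemma extend_linear_widen e (f : {poly R}) n : (size f <= n)%N ->
  extend_linear e f = \sum_(i < n) f`_i *: e i.
Proof.
move=> le_fn; rewrite /extend_linear (big_ord_widen n (fun i => f`_i *: e i) le_fn).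
rewrite big_mkcond; apply: eq_bigr => i _; case: ltnP => // le_fi.
by rewrite nth_default // scale0r.
Qed.

Lemma extend_linear_is_linear e : linear (extend_linear e).
Proof.
move=> c f g; set n := maxn (size f) (size g).
have le_n : (size (c *: f + g)%R <= n)%N.
  apply: leq_trans (size_polyD _ _) _.
  by rewrite geq_max !leq_max leqnn (size_scale_leq c f) orbT.
rewrite (extend_linear_widen e le_n) (@extend_linear_widen e f n) ?leq_maxl //.
rewrite (@extend_linear_widen e g n) ?leq_maxr // scaler_sumr -big_split.
by apply: eq_bigr => i _; rewrite coefD coefZ scalerDl scalerA.
Qed.

HB.instance Definition _ e :=
  GRing.isLinear.Build R {poly R} V *:%R (extend_linear e) (extend_linear_is_linear e).

Lemma extend_linearXn e n : extend_linear e 'X^n = e n.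
Proof.
rewrite (@extend_linear_widen e _ n.+1) ?size_polyXn // big_ord_recr /= big1 => [|i _].
  by rewrite coefXn eqxx scale1r add0r.
by rewrite coefXn ltn_eqF // scale0r.
Qed.

End LinearExtension.

Section Monomials.
Context {R : realFieldType}.

Lemma poly_monomial_ind (P : {poly R} -> Prop) :
  P 0 -> (forall n, P 'X^n) -> (forall c f g, P f -> P g -> P (c *: f + g)) ->
  forall f, P f.
Proof.
move=> P0 PX PD f; rewrite -[f]coefK poly_def.
by apply: big_ind => // [g h Pg Ph | i _];
   [rewrite -[g]scale1r | rewrite -[_ *: _]addr0]; apply: PD.
Qed.

Definition nncoef (f : {poly R}) : Prop := forall i, 0 <= f`_i.

Lemma nncoef_ind (P : {poly R} -> Prop) :
  P 0 -> (forall n, P 'X^n) ->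
  (forall c f g, 0 <= c -> P f -> P g -> P (c *: f + g)) ->
  forall f, nncoef f -> P f.
Proof.
move=> P0 PX PD f f_ge0; rewrite -[f]coefK poly_def.
elim: (size f) => [|n IH]; first by rewrite big_ord0.
by rewrite big_ord_recr /= addrC; apply: PD.
Qed.

Lemma nncoefXn n : nncoef 'X^n.
Proof. by move=> i; rewrite coefXn ler0n. Qed.

Lemma nncoefD f g : nncoef f -> nncoef g -> nncoef (f + g).
Proof. by move=> f_ge0 g_ge0 i; rewrite coefD addr_ge0. Qed.

Lemma nncoefZ c f : 0 <= c -> nncoef f -> nncoef (c *: f).
Proof. by move=> c_ge0 f_ge0 i; rewrite coefZ mulr_ge0. Qed.

Lemma nncoefM f g : nncoef f -> nncoef g -> nncoef (f * g).
Proof.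
by move=> f_ge0 g_ge0 i; rewrite coefM sumr_ge0 // => j _; rewrite mulr_ge0.
Qed.

End Monomials.

Section LinearForms.
Context {R : realFieldType}.

Definition linear_form (phi : {poly R} -> R) : Prop :=
  forall c f g, phi (c *: f + g) = c * phi f + phi g.

Variable phi : {poly R} -> R.
Hypothesis phiP : linear_form phi.

Lemma linear_form0 : phi 0 = 0.
Proof. by have := phiP (-1) 0 0; rewrite scaler0 addr0 mulN1r addNr. Qed.

Lemma linear_formE f : phi f = \sum_(i < size f) f`_i * phi 'X^i.
Proof.
have phiD g h : phi (g + h) = phi g + phi h.
  by rewrite -[g in LHS]scale1r phiP mul1r.
rewrite -[f in LHS]coefK poly_def (big_morph phi phiD linear_form0).
by apply: eq_bigr => i _; rewrite -[_ *: _]addr0 phiP linear_form0 addr0.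
Qed.

End LinearForms.

(** * The matrix product relations on polynomials *)

Section Recursion.
Context {T : Type} (x0 : T).

Lemma strong_recursion (F : nat -> seq T -> T) :
  exists m : nat -> T, forall n, m n = F n (mkseq m n).
Proof.
pose s n := iteri n (fun k s => rcons s (F k s)) [::].
have size_s n : size (s n) = n by elim: n => //= n IH; rewrite size_rcons IH.
have nth_s n k : (k < n)%N -> nth x0 (s n) k = F k (s k).
  elim: n => // n IH; rewrite ltnS leq_eqVlt => /orP[/eqP->|lt_kn].
    by rewrite /= nth_rcons size_s ltnn eqxx.
  by rewrite /= nth_rcons size_s lt_kn IH.
exists (fun n => F n (s n)) => n; congr (F n _).
apply: (@eq_from_nth _ x0) => [|k]; rewrite size_s ?size_mkseq // => lt_kn.
by rewrite nth_s // nth_mkseq.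
Qed.

End Recursion.

Section Algebra.
Context {R : realFieldType} (q al be ga de : R).
Hypotheses (q_ge0 : 0 <= q) (q_lt1 : q < 1).
Hypotheses (al_gt0 : 0 < al) (ga_ge0 : 0 <= ga) (de_ge0 : 0 <= de).

(** The relation DE - q ED = D + E reads [E ('X f) = (q 'X + 1) E f + 'X f] once
    D is multiplication by ['X], and the relation at the left end prescribes
    [E 1]; together they give E on every monomial.  Words are read from the left
    end, so that the first letter acts first. *)
Fixpoint hole_monomial (n : nat) : {poly R} :=
  if n is k.+1 then (q *: 'X + 1) * hole_monomial k + 'X^n
  else (ga / al) *: 'X + (al^-1)%:P.

Definition hole : {poly R} -> {poly R} := extend_linear hole_monomial.
HB.instance Definition _ := GRing.Linear.on hole.

Definition letter (b : bool) (f : {poly R}) : {poly R} :=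
  if b then 'X * f else hole f.

Lemma hole1 : hole 1 = (ga / al) *: 'X + (al^-1)%:P.
Proof. by rewrite -[1](expr0 'X) /hole extend_linearXn. Qed.

Lemma holeX f : hole ('X * f) = (q *: 'X + 1) * hole f + 'X * f.
Proof.
elim/(@poly_monomial_ind R): f => [|n|c f g IHf IHg].
- by rewrite !(mulr0, linear0, addr0).
- by rewrite -exprS /hole !extend_linearXn.
- have holeP c1 f1 g1 : hole (c1 *: f1 + g1) = c1 *: hole f1 + hole g1.
    exact: linearP.
  rewrite mulrDr -scalerAr !holeP IHf IHg scalerDr !mulrDr -!scalerAr.
  by rewrite addrACA.
Qed.

Lemma hole_nncoef f : nncoef f -> nncoef (hole f).
Proof.
have X_ge0 c d : 0 <= c -> 0 <= d -> nncoef (c *: 'X + d%:P).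
  move=> c_ge0 d_ge0; rewrite -['X]expr1 -[d%:P]mulr1 mul_polyC -(expr0 'X).
  by apply: nncoefD; apply: nncoefZ => //; apply: nncoefXn.
elim/(@nncoef_ind R) => [|n|c {}f g c_ge0 IHf IHg].
- by rewrite linear0 => i; rewrite coef0.
- rewrite /hole extend_linearXn; elim: n => [|n IHn] /=.
    by apply: X_ge0; rewrite ?divr_ge0 ?invr_ge0 // ltW.
  by apply: nncoefD (nncoefXn _); apply: nncoefM => //; apply: X_ge0.
- by rewrite linearP; apply: nncoefD => //; apply: nncoefZ.
Qed.

(** With [lead_hole_monomial] this isolates the unknown moment in the relation
    at the right end: only the leading term of [E 'X^n] has degree [n.+1]. *)
Lemma size_hole_monomial n : (size (hole_monomial n) <= n.+2)%N.
Proof.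
elim: n => [|n IHn] /=.
  apply: leq_trans (size_polyD _ _) _; rewrite geq_max.
  rewrite (leq_trans (size_scale_leq _ _)) ?size_polyX //.
  by rewrite (leq_trans (size_polyC_leq1 _)).
apply: leq_trans (size_polyD _ _) _; rewrite geq_max size_polyXn leqnSn andbT.
apply: leq_trans (size_polyMleq _ _) _.
suff : (size (q *: 'X + 1)%R <= 2)%N.
  by move=> le2; rewrite -subn1 leq_subLR; apply: leq_add le2 IHn.
apply: leq_trans (size_polyD _ _) _; rewrite geq_max size_poly1 andbT.
by rewrite (leq_trans (size_scale_leq _ _)) ?size_polyX.
Qed.

Lemma lead_hole_monomial n : (hole_monomial n)`_n.+1 = ga / al * q ^+ n.
Proof.
elim: n => [|n IHn] /=.
  by rewrite coefD coefZ coefX coefC /= !mulr1 addr0.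
rewrite coefD coefXn gtn_eqF // addr0 mulrDl mul1r coefD -scalerAl coefZ coefXM /=.
rewrite IHn nth_default ?size_hole_monomial // addr0 exprS; ring.
Qed.

(** The coefficient of the unknown moment never vanishes, since [q ^+ n <= 1]. *)
Lemma pivot_lt n : ga * de < al * be -> de * (ga / al * q ^+ n) < be.
Proof.
move=> hab; have : de * (ga / al * q ^+ n) <= de * (ga / al).
  apply: ler_wpM2l => //; apply: ler_piMr; first by rewrite divr_ge0 // ltW.
  by rewrite exprn_ile1 // ltW.
by move/le_lt_trans; apply; rewrite mulrA ltr_pdivrMr // mulrC [be * _]mulrC.
Qed.

(** By linearity the relation at the right end is one equation per monomial
    ['X^n], and it expresses the moment of order [n.+1] through those of lower
    order with nonnegative coefficients. *)
Lemma ansatz_functional_exists : ga * de < al * be ->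
  exists phi : {poly R} -> R,
  [/\ linear_form phi,
      phi 1 = 1, forall f, nncoef f -> 0 <= phi f &
      forall f, be * phi ('X * f) = de * phi (hole f) + phi f].
Proof.
move=> hab.
have c_gt0 n : 0 < be - de * (ga / al * q ^+ n).
  by rewrite subr_gt0 pivot_lt.
pose F n (s : seq R) : R := if n is k.+1 then
  (be - de * (ga / al * q ^+ k))^-1 *
  (s`_k + de * \sum_(i < k.+1) (hole_monomial k)`_i * s`_i) else 1.
have [m mE] := strong_recursion 0 F.
have m0 : m 0%N = 1 by rewrite mE.
have mS n : (be - de * (ga / al * q ^+ n)) * m n.+1 =
    m n + de * \sum_(i < n.+1) (hole_monomial n)`_i * m i.
  rewrite mE /F mulVKf ?gt_eqF // nth_mkseq //.
  by congr (_ + _ * _); apply: eq_bigr => i _; rewrite nth_mkseq.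
pose phi f : R := extend_linear (m : nat -> R^o) f.
have phiP : linear_form phi by exact: (@extend_linear_is_linear R R^o).
have phiX n : phi 'X^n = m n by exact: (@extend_linearXn R R^o).
exists phi; split=> //.
- by rewrite -[1 in LHS](expr0 'X) phiX.
- have m_ge0 n : 0 <= m n.
    elim/ltn_ind: n => -[|n] IH; first by rewrite m0.
    rewrite -(pmulr_rge0 _ (c_gt0 n)) mS addr_ge0 ?IH // mulr_ge0 // sumr_ge0 //.
    move=> i _; rewrite mulr_ge0 ?IH ?ltn_ord //.
    by have := hole_nncoef (nncoefXn n) i; rewrite /hole extend_linearXn.
  by move=> f f_ge0; apply: sumr_ge0 => i _; apply: mulr_ge0.
have phi0 := linear_form0 phiP.
elim/(@poly_monomial_ind R) => [|n|c f g IHf IHg].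
- by rewrite mulr0 linear0 !phi0 !mulr0 addr0.
- rewrite -exprS /hole extend_linearXn !phiX.
  have -> : phi (hole_monomial n) =
    \sum_(i < n.+1) (hole_monomial n)`_i * m i + ga / al * q ^+ n * m n.+1.
    rewrite /phi (@extend_linear_widen R R^o _ _ _ (size_hole_monomial n)).
    by rewrite big_ord_recr /= lead_hole_monomial.
  have := mS n; rewrite mulrBl => /(canRL (subrK _)) ->.
  by rewrite mulrDr [RHS]addrC addrA !mulrA.
- rewrite mulrDr -scalerAr linearP !phiP !mulrDr mulrCA IHf IHg.
  by rewrite [de * (c * _)]mulrCA mulrDr addrACA.
Qed.

End Algebra.

(** * Sums over words *)

Section Words.
Context {R : realFieldType}.

(** Sums over binary words of length [N], in the form that lets induction on [N]
    peel off the first letter. *)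
Fixpoint sum_words (N : nat) (F : seq bool -> R) : R :=
  if N is n.+1 then \sum_(b : bool) sum_words n (fun w => F (b :: w)) else F [::].

Lemma eq_sum_words N (F G : seq bool -> R) :
  (forall w, size w = N -> F w = G w) -> sum_words N F = sum_words N G.
Proof.
elim: N F G => [|N IHN] F G eqFG /=; first exact: eqFG.
by apply: eq_bigr => b _; apply: IHN => w sz_w; apply: eqFG; rewrite /= sz_w.
Qed.

Lemma sum_wordsM c N (F : seq bool -> R) : sum_words N (fun w => c * F w) = c * sum_words N F.
Proof.
elim: N F => //= N IHN F; rewrite mulr_sumr.
by apply: eq_bigr => b _; rewrite IHN.
Qed.

Lemma sum_wordsD N (F G : seq bool -> R) :
  sum_words N (fun w => F w + G w) = sum_words N F + sum_words N G.
Proof.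
elim: N F G => //= N IHN F G; rewrite -big_split.
by apply: eq_bigr => b _; rewrite IHN.
Qed.

Lemma sum_words_tuple N (F : seq bool -> R) :
  \sum_(w : N.-tuple bool) F w = sum_words N F.
Proof.
elim: N F => [|N IHN] F /=.
  by rewrite (big_pred1 [tuple]) // => w; apply/esym/eqP; apply: tuple0.
rewrite [RHS](eq_bigr _ (fun b _ => esym (IHN (fun w => F (b :: w))))).
rewrite [RHS]pair_big /=.
rewrite (reindex (fun bw : bool * N.-tuple bool => [tuple of bw.1 :: bw.2])) //=.
exists (fun w => (thead w, [tuple of behead w])) => [[b w] _ | w _] /=.
  by congr (_, _); apply: val_inj.
by rewrite [RHS]tuple_eta; apply: val_inj.
Qed.

Lemma sum_words_rev N (F : seq bool -> R) : sum_words N (fun w => F (rev w)) = sum_words N F.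
Proof.
pose rev_tuple (w : N.-tuple bool) := [tuple of rev w].
rewrite -!sum_words_tuple [RHS](reindex_inj (h := rev_tuple)) //.
by move=> w1 w2 /(congr1 val) /= /(can_inj revK) eq_w; apply: val_inj.
Qed.

Lemma sum_words_map_negb N (F : seq bool -> R) :
  sum_words N (fun w => F (map negb w)) = sum_words N F.
Proof.
elim: N F => //= N IHN F.
rewrite !big_bool /= addrC.
by rewrite (IHN (fun w => F (true :: w))) (IHN (fun w => F (false :: w))).
Qed.

End Words.

(** * The upper bound by product measures *)

Section Transfer.
Context {R : realFieldType} (q al be ga de : R).
Hypotheses (q_ge0 : 0 <= q) (q_lt1 : q < 1).
Hypotheses (al_gt0 : 0 < al) (ga_ge0 : 0 <= ga) (de_ge0 : 0 <= de).
Hypothesis hab : ga * de < al * be.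

Definition act (w : seq bool) (f : {poly R}) : {poly R} :=
  foldl (fun f b => letter q al ga b f) f w.

Definition transfer (x : R) (f : {poly R}) : {poly R} :=
  hole q al ga f + x *: ('X * f).

Lemma transferP x c f g :
  transfer x (c *: f + g) = c *: transfer x f + transfer x g.
Proof.
rewrite /transfer linearP mulrDr -scalerAr !scalerDr.
by rewrite addrACA scalerA mulrC -scalerA.
Qed.

Lemma iter_transferP x N c f g :
  iter N (transfer x) (c *: f + g) =
  c *: iter N (transfer x) f + iter N (transfer x) g.
Proof. by elim: N => //= N ->; rewrite transferP. Qed.

Lemma nncoef_transfer x f : 0 <= x -> nncoef f -> nncoef (transfer x f).
Proof.
move=> x_ge0 f_ge0; apply: nncoefD.
  exact: (hole_nncoef q_ge0 al_gt0 ga_ge0).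
apply: nncoefZ => //; apply: nncoefM => //.
by rewrite -['X]expr1; apply: nncoefXn.
Qed.

Lemma nncoef_iter_transfer x f N :
  0 <= x -> nncoef f -> nncoef (iter N (transfer x) f).
Proof. by move=> x_ge0 f_ge0; elim: N => //= N; apply: nncoef_transfer. Qed.

Section Functional.
Variable phi : {poly R} -> R.
Hypothesis phiP : linear_form phi.
Hypothesis phi1 : phi 1 = 1.
Hypothesis phi_ge0 : forall f, nncoef f -> 0 <= phi f.
Hypothesis phiX : forall f, be * phi ('X * f) = de * phi (hole q al ga f) + phi f.

Lemma sum_words_transfer x N f :
  sum_words N (fun w => x ^+ count id w * phi (act w f)) =
  phi (iter N (transfer x) f).
Proof.
elim: N f => [|N IHN] f; first by rewrite /= expr0 mul1r.
rewrite iterSr /transfer addrC iter_transferP phiP -!IHN /=.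
rewrite big_bool -sum_wordsM; congr (_ + _); apply: eq_sum_words => w _ /=.
by rewrite exprS -mulrA.
Qed.

(** The other monomials contribute a nonnegative amount to [phi f]. *)
Lemma coef0_le_functional f : nncoef f -> f.[0] <= phi f.
Proof.
move=> f_ge0; rewrite horner_coef0.
have -> : phi f = f`_0 + phi (f - (f`_0)%:P).
  by rewrite -[X in X + _]mulr1 -phi1 -phiP alg_polyC addrC subrK.
rewrite lerDl; apply: phi_ge0 => i; rewrite coefB coefC.
by case: eqP => [->|_]; rewrite ?subrr ?subr0.
Qed.

End Functional.

Section UpperBound.

(** The value that the operator of an occupied site takes in the product
    measure with odds 1/v.  It is locked because rewriting with associativity
    would otherwise look inside the quotient. *)
Definition fugacity (v : R) : R := locked ((1 + v) / (v * (1 - q))).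

Let hE := (@hornerD R, @hornerZ R, @hornerM R, @hornerX R, @hornerC R, @hornerXn R).

Variable v : R.
Hypothesis v_gt0 : 0 < v.
Local Notation X0 := (fugacity v).

Lemma fugacity_gt0 : 0 < X0.
Proof.
have h1 : 0 < 1 + v by rewrite addr_gt0.
have h2 : 0 < 1 - q by rewrite subr_gt0.
by rewrite /fugacity -lock; apply: divr_gt0 => //; apply: mulr_gt0.
Qed.

Definition growth x : R := (1 + v) * (1 + x / v) / (1 - q).

Lemma growth_gt0 x : 0 < x -> 0 < growth x.
Proof.
move=> x_gt0; apply: divr_gt0; last by rewrite subr_gt0.
by apply: mulr_gt0; apply: addr_gt0 => //; apply: divr_gt0.
Qed.

Lemma growthE x : growth x = v * X0 + x * X0.
Proof. by rewrite /growth /fugacity -lock; field; rewrite !gt_eqF // subr_gt0. Qed.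

Lemma fugacityE : v * (1 - q) * X0 = 1 + v.
Proof.
have h : 1 - q != 0 by rewrite gt_eqF // subr_gt0.
by rewrite /fugacity -lock mulrC divfK // mulf_neq0 // gt_eqF.
Qed.

Section LeftBoundary.
Hypothesis left_v : (1 - q) * v <= (al * v - ga) * (1 + v).

(** On monomials this is an induction along the recursion for E; the constant
    [v * X0] is the fixed point of that recursion, because
    [v * (1 - q) * X0 = 1 + v]. *)
Lemma hole_eval_le f : nncoef f -> (hole q al ga f).[X0] <= v * X0 * f.[X0].
Proof.
have X0_gt0 := fugacity_gt0; have X0E := fugacityE.
elim/(@nncoef_ind R) => [|n|c {}f g c_ge0 IHf IHg].
- by rewrite linear0 horner0 mulr0.
- rewrite /hole extend_linearXn hornerXn; elim: n => [|n IHn] /=.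
    rewrite !hE.
    have : 1 <= (al * v - ga) * X0.
      rewrite /fugacity -lock mulrA ler_pdivlMr; last by rewrite mulr_gt0 // subr_gt0.
      by rewrite mul1r mulrC.
    move=> h; rewrite -(ler_pM2l al_gt0) mulrDr mulfV ?gt_eqF //.
    have -> : al * (ga / al * X0) = ga * X0.
      by rewrite mulrA [al * _]mulrC divfK ?gt_eqF.
    by lra.
  rewrite !hE !exprS.
  have : (q * X0 + 1) * (hole_monomial q al ga n).[X0] <= (q * X0 + 1) * (v * X0 * X0 ^+ n).
    by apply: ler_wpM2l => //; rewrite addr_ge0 // mulr_ge0 // ltW.
  have := congr1 ( *%R (X0 * X0 ^+ n)) X0E; lra.
- rewrite linearP !hE mulrDr; apply: lerD => //.
  by rewrite mulrCA; apply: ler_wpM2l.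
Qed.

Lemma transfer_eval_le x f : 0 < x -> nncoef f ->
  (transfer x f).[X0] <= growth x * f.[X0].
Proof.
move=> x_gt0 f_ge0; have := hole_eval_le f_ge0; rewrite /transfer !hE.
have -> : growth x * f.[X0] =
          v * X0 * f.[X0] + x * (X0 * f.[X0]).
  by rewrite growthE mulrDl -[x * X0 * _]mulrA.
lra.
Qed.

Lemma iter_transfer_eval_le x f N : 0 < x -> nncoef f ->
  (iter N (transfer x) f).[X0] <=
  growth x ^+ N * f.[X0].
Proof.
move=> x_gt0 f_ge0; elim: N => [|N IHN]; first by rewrite expr0 mul1r.
rewrite iterS exprS -mulrA; apply: le_trans (transfer_eval_le x_gt0 _) _.
  by apply: nncoef_iter_transfer => //; apply: ltW.
apply: ler_wpM2l => //.
by apply/ltW/growth_gt0.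
Qed.

Section RightBoundary.
Hypothesis right_v : (1 - q) * v <= (be - de * v) * (1 + v).
Variable phi : {poly R} -> R.
Hypothesis phiP : linear_form phi.
Hypothesis phi1 : phi 1 = 1.
Hypothesis phiX : forall f, be * phi ('X * f) = de * phi (hole q al ga f) + phi f.

(** Evaluation at [X0] satisfies the recursion for the moments of [phi] as an
    inequality in the favourable direction, so that it stays above [phi]. *)
Lemma functional_le_eval f : nncoef f -> phi f <= f.[X0].
Proof.
have X0_gt0 := fugacity_gt0.
have le_mon g n : nncoef g -> (size g <= n)%N ->
    (forall i, (i < n)%N -> phi 'X^i <= X0 ^+ i) -> phi g <= g.[X0].
  move=> g_ge0 sz_g le_n; rewrite (linear_formE phiP) horner_coef.
  by apply: ler_sum => i _; apply: ler_wpM2l; rewrite ?le_n ?(leq_trans (ltn_ord i)).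
suff le_X n : phi 'X^n <= X0 ^+ n.
  by move=> f_ge0; apply: (le_mon _ (size f)).
elim/ltn_ind: n => -[|n] IHn; first by rewrite !expr0 phi1.
(* [h] is [E 'X^n] without its leading term, which carries the new moment *)
pose G := ga / al * q ^+ n; pose h := hole q al ga 'X^n - G *: 'X^(n.+1).
have h_def : hole q al ga 'X^n = G *: 'X^(n.+1) + h by rewrite addrC subrK.
have hX i : (hole q al ga 'X^n)`_i = (hole_monomial q al ga n)`_i.
  by rewrite /hole extend_linearXn.
have sz_h : (size h <= n.+1)%N.
  apply/leq_sizeP => j; rewrite leq_eqVlt => /orP[/eqP<-|lt_nj].
    by rewrite /h coefB coefZ coefXn eqxx hX lead_hole_monomial mulr1 subrr.
  rewrite /h coefB coefZ coefXn gtn_eqF // hX nth_default ?mulr0 ?subr0 //.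
  by apply: leq_trans (size_hole_monomial _ _ _ _) _.
have h_ge0 : nncoef h.
  move=> i; have [->|neq_i] := eqVneq i n.+1.
    by rewrite /h coefB coefZ coefXn eqxx hX lead_hole_monomial mulr1 subrr.
  rewrite /h coefB coefZ coefXn (negPf neq_i) mulr0 subr0.
  exact: (hole_nncoef q_ge0 al_gt0 ga_ge0 (nncoefXn n)).
have h_le : phi h <= h.[X0] by apply: (le_mon _ n.+1).
have G_lt : de * G < be by apply: pivot_lt.
clearbody h.
have eval_le := hole_eval_le (nncoefXn n).
move: (phiX 'X^n) eval_le h_le; rewrite -exprS h_def phiP !hE /=.
have IH := IHn n (ltnSn n).
have right_X : 1 + de * v * X0 <= be * X0.
  suff : 1 <= (be - de * v) * X0 by lra.
  rewrite /fugacity -lock mulrA ler_pdivlMr; last by rewrite mulr_gt0 // subr_gt0.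
  by rewrite mul1r mulrC.
move=> E1 E2 E3.
have P_ge0 : 0 <= X0 ^+ n by rewrite exprn_ge0 // ltW.
have := ler_wpM2l de_ge0 E3; have := ler_wpM2l de_ge0 E2.
have := ler_wpM2r P_ge0 right_X.
rewrite -subr_gt0 in G_lt; move=> E4 E5 E6.
rewrite -(ler_pM2l G_lt) ![X0 ^+ n.+1]exprS; move: E5; rewrite [X0 ^+ n.+1]exprS.
lra.
Qed.

Lemma partition_fun_upper x N : 0 < x ->
  sum_words N (fun w => x ^+ count id w * phi (act w 1)) <=
  growth x ^+ N.
Proof.
move=> x_gt0; have n1 : nncoef (1 : {poly R}) by rewrite -(expr0 'X); apply: nncoefXn.
rewrite (sum_words_transfer phiP) -[leRHS]mulr1 -(hornerC 1 X0).
apply: le_trans (iter_transfer_eval_le N x_gt0 n1).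
by apply: functional_le_eval; apply: nncoef_iter_transfer => //; apply: ltW.
Qed.

End RightBoundary.

End LeftBoundary.
End UpperBound.
End Transfer.

(** * The lower bound by sub-eigenvectors *)

Section Tridiagonal.
Context {R : realFieldType}.

(** A row vector [r N], iterated by a nonnegative tridiagonal matrix, spreads
    over the support of [psi] in [M] steps.  From then on it dominates a multiple
    of [L ^+ N * psi], and it comes back to the origin in [n1] steps. *)
Lemma tridiagonal_growth (u d l psi : nat -> R) (r : nat -> nat -> R)
    (M n1 : nat) (L : R) :
  (forall n, 0 < u n) -> (forall n, 0 < d n) -> (forall n, 0 < l n.+1) -> l 0%N = 0 ->
  0 < r 0%N 0%N -> (forall n, 0 <= r 0%N n) ->
  (forall N n, r N.+1 n = u n * r N n.+1 + d n * r N n + l n * r N n.-1) ->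
  0 <= L -> (forall n, 0 <= psi n) -> (forall n, (M <= n)%N -> psi n = 0) ->
  0 < psi n1 ->
  (forall n, L * psi n <= u n * psi n.+1 + d n * psi n + l n * psi n.-1) ->
  exists c k, 0 < c /\ forall N, c * L ^+ N <= r (k + N)%N 0%N.
Proof.
move=> u_gt0 d_gt0 l_gt0 l0 r00 r0_ge0 rS L_ge0 psi_ge0 psi_supp psi_n1 psiL.
have l_ge0 n : 0 <= l n by case: n => [|n]; rewrite ?l0 // ltW.
have r_ge0 N n : 0 <= r N n.
  elim: N n => // N IHN n; rewrite rS !addr_ge0 // mulr_ge0 //; exact: ltW.
have r_gt0 N n : (n <= N)%N -> 0 < r N n.
  elim: N n => [|N IHN] [|n] // le_nN; rewrite rS.
    by rewrite ltr_wpDr ?mulr_ge0 // ltr_wpDl ?mulr_ge0 ?mulr_gt0 ?IHN // ltW.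
  rewrite ltr_wpDl //; last by rewrite mulr_gt0 ?IHN.
  by rewrite addr_ge0 // mulr_ge0 // ltW.
pose S := \sum_(i < M) psi i / r M i.
have S_ge0 : 0 <= S by apply: sumr_ge0 => i _; rewrite divr_ge0.
have psi_le n : psi n <= (S + 1) * r M n.
  have [le_Mn|lt_nM] := leqP M n; first by rewrite psi_supp // mulr_ge0 ?addr_ge0.
  rewrite -ler_pdivrMr ?r_gt0 // ?(ltnW lt_nM) //.
  rewrite /S (bigD1 (Ordinal lt_nM)) //= -addrA lerDl addr_ge0 //.
  by apply: sumr_ge0 => i _; rewrite divr_ge0.
have lower N n : L ^+ N * psi n <= (S + 1) * r (M + N)%N n.
  elim: N n => [|N IHN] n; first by rewrite addn0 expr0 mul1r.
  rewrite addnS rS exprSr -mulrA.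
  apply: le_trans (ler_wpM2l _ (psiL n)) _; first exact: exprn_ge0.
  rewrite !mulrDr !(mulrCA (L ^+ N)) !(mulrCA (S + 1)).
  by rewrite !lerD // ler_wpM2l // ltW.
have descent N n : exists2 c, 0 < c & forall m, c * r (M + m)%N (n + N)%N <= r (M + m + N)%N n.
  elim: N n => [|N IHN] n; first by exists 1 => // m; rewrite mul1r !addn0.
  have [c c_gt0 le_c] := IHN n.+1.
  exists (u n * c) => [|m]; first exact: mulr_gt0.
  rewrite [(M + m + N.+1)%N]addnS rS -mulrA -addrA; apply: ler_wpDr.
    by rewrite addr_ge0 ?mulr_ge0 // ltW.
  by apply: ler_wpM2l; [exact: ltW | rewrite -[(n + N.+1)%N]addSnnS].
have [c c_gt0 le_c] := descent n1 0%N.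
exists (c * psi n1 / (S + 1)), (M + n1)%N; split.
  by rewrite divr_gt0 ?mulr_gt0 // ltr_wpDl.
move=> N; rewrite addnAC; apply: le_trans (le_c N).
rewrite add0n -!mulrA ler_wpM2l ?(ltW c_gt0) // mulrCA.
by rewrite ler_pdivrMl ?ltr_wpDl // mulrC.
Qed.

End Tridiagonal.

Section QBrackets.
Context {R : realFieldType} (q al ga : R).
Hypotheses (q_gt0 : 0 < q) (q_lt1 : q < 1).
Hypotheses (al_gt0 : 0 < al) (ga_ge0 : 0 <= ga).

Definition qint (n : nat) : R := \sum_(i < n) q ^+ i.

Lemma qint0 : qint 0 = 0. Proof. by rewrite /qint big_ord0. Qed.

Lemma qintS n : qint n.+1 = qint n + q ^+ n.
Proof. by rewrite /qint big_ord_recr. Qed.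

Lemma qint_recl n : qint n.+1 = 1 + q * qint n.
Proof.
rewrite /qint big_ord_recl expr0 mulr_sumr; congr (_ + _).
by apply: eq_bigr => i _; rewrite exprS.
Qed.

Lemma qint_closed n : (1 - q) * qint n = 1 - q ^+ n.
Proof.
elim: n => [|n IHn]; first by rewrite qint0 mulr0 expr0 subrr.
by rewrite qintS mulrDr IHn exprS; ring.
Qed.

Lemma qint_ge0 n : 0 <= qint n.
Proof. by apply: sumr_ge0 => i _; rewrite exprn_ge0 // ltW. Qed.

(** In this basis both D and E are tridiagonal with nonnegative entries, which
    fails for monomials: there E has unboundedly many lower terms. *)
Definition falling (n : nat) : {poly R} := \prod_(k < n) ('X - (qint k)%:P).

Lemma fallingS n : falling n.+1 = ('X - (qint n)%:P) * falling n.
Proof. by rewrite /falling big_ord_recr mulrC. Qed.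

Lemma fallingX n : 'X * falling n = falling n.+1 + qint n *: falling n.
Proof. by rewrite fallingS mulrBl mul_polyC subrK. Qed.

Fixpoint hole_diag (n : nat) : R :=
  if n is k.+1 then
    q * hole_diag k + 1 + ga / al * q ^+ k * (q ^+ k + q ^+ k.+1)
  else al^-1.

Fixpoint hole_down (n : nat) : R :=
  if n is k.+1 then q * hole_down k + qint k + q ^+ k * hole_diag k else 0.

Lemma hole_falling n :
  hole q al ga (falling n) = (ga / al * q ^+ n) *: falling n.+1 +
    hole_diag n *: falling n + hole_down n *: falling n.-1.
Proof.
have holeN c f : hole q al ga (c *: f) = c *: hole q al ga f by exact: linearZ.
elim: n => [|n IHn].
  rewrite /falling big_ord0 big_ord1 qint0 subr0 hole1 /= scale0r addr0 expr0 mulr1.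
  by rewrite alg_polyC.
have shift m : (q *: 'X + 1) * falling m - qint n *: falling m =
    q *: falling m.+1 + (qint m.+1 - qint n) *: falling m.
  rewrite mulrDl mul1r -scalerAl fallingX scalerDr scalerA qint_recl scalerBl.
  by rewrite scalerDl scale1r [falling m + _ in RHS]addrC !addrA.
have shift_pred : hole_down n *: ((q *: 'X + 1) * falling n.-1 - qint n *: falling n.-1) =
    hole_down n *: (q *: falling n).
  have [n0|n_gt0] := posnP n; last by rewrite shift prednK // subrr scale0r addr0.
  by have -> : hole_down n = 0 by [rewrite n0]; rewrite !scale0r.
rewrite {1}fallingS mulrBl mul_polyC linearB /= holeN holeX IHn fallingX.
transitivity (ga / al * q ^+ n *: (q *: falling n.+2 + (qint n.+2 - qint n) *: falling n.+1)
  + hole_diag n *: (q *: falling n.+1 + (qint n.+1 - qint n) *: falling n)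
  + hole_down n *: (q *: falling n) + (falling n.+1 + qint n *: falling n)).
  rewrite -shift_pred -!shift -!mul_polyC; ring.
rewrite !qintS exprS -!mul_polyC !(polyCD, polyCN, polyCM); ring.
Qed.

(** The entries of E exceed those of the case alpha = infinity, gamma = 0, in
    which they are explicit.  The bounds are sharp in the limit, where the matrix
    of H becomes Toeplitz. *)
Lemma hole_diag_ge n : qint n <= hole_diag n.
Proof.
elim: n => [|n IHn] /=; first by rewrite qint0 invr_ge0 ltW.
rewrite qint_recl.
have := ler_wpM2l (ltW q_gt0) IHn.
have : 0 <= ga / al * q ^+ n * (q ^+ n + q ^+ n.+1).
  have qk_ge0 k : 0 <= q ^+ k by rewrite exprn_ge0 // ltW.
  by rewrite !mulr_ge0 ?addr_ge0 ?invr_ge0 ?(ltW al_gt0).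
lra.
Qed.

Lemma hole_down_ge n : qint n.+1 * qint n <= hole_down n.+1.
Proof.
elim: n => [|n IHn] /=.
  by rewrite qint0 !mulr0 add0r expr0 mul1r add0r invr_ge0 ltW.
have := ler_wpM2l (ltW q_gt0) IHn.
have qn_ge0 : 0 <= q ^+ n.+1 by rewrite exprn_ge0 // ltW.
have := ler_wpM2l qn_ge0 (hole_diag_ge n.+1).
rewrite /=; move: (hole_diag n.+1) (hole_down n.+1) => /= B D.
rewrite [qint n.+2]qintS; have := qint_recl n.+1.
by have := qintS n; have := qint_recl n; rewrite exprS; nra.
Qed.

Lemma hole_diag_gt0 n : 0 < hole_diag n.
Proof.
case: n => [|n]; first by rewrite invr_gt0.
apply: lt_le_trans (hole_diag_ge _); rewrite qint_recl ltr_wpDr // mulr_ge0 ?qint_ge0 //.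
exact: ltW.
Qed.

Lemma hole_down_gt0 n : 0 < hole_down n.+1.
Proof.
have down_ge0 k : 0 <= hole_down k.
  elim: k => //= k IHk; rewrite !addr_ge0 ?qint_ge0 ?mulr_ge0 ?exprn_ge0 ?(ltW q_gt0) //.
  exact/ltW/hole_diag_gt0.
rewrite /= ltr_wpDl ?mulr_gt0 ?exprn_gt0 ?hole_diag_gt0 //.
by rewrite addr_ge0 ?qint_ge0 ?mulr_ge0 ?down_ge0 // ltW.
Qed.

End QBrackets.

Section LowerBound.
Context {R : realType} (q al ga : R).
Hypotheses (q_gt0 : 0 < q) (q_lt1 : q < 1).
Hypotheses (al_gt0 : 0 < al) (ga_ge0 : 0 <= ga).

Lemma geometric_small (t : R) : 0 < t -> exists n0, forall n, (n0 <= n)%N -> q ^+ n <= t.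
Proof.
move=> t_gt0; have : (GRing.exp q @ \oo --> (0 : R))%classic.
  by apply: cvg_expr; rewrite gtr0_norm.
move/cvgrPdist_le => /(_ t t_gt0) [n0 _ hn0]; exists n0 => n le_n.
by have := hn0 n le_n; rewrite sub0r normrN ger0_norm // exprn_ge0 // ltW.
Qed.

Variable x : R.
Hypothesis x_gt0 : 0 < x.

Definition up_rate (n : nat) : R := x + ga / al * q ^+ n.
Definition stay_rate (n : nat) : R := hole_diag q al ga n + x * qint q n.

Lemma transfer_falling n :
  transfer q al ga x (falling q n) = up_rate n *: falling q n.+1 +
    stay_rate n *: falling q n + hole_down q al ga n *: falling q n.-1.
Proof.
rewrite /transfer hole_falling // fallingX /up_rate /stay_rate.
by rewrite -!mul_polyC !(polyCD, polyCM); ring.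
Qed.

Lemma up_rate_ge n : x <= up_rate n.
Proof. by rewrite lerDl !mulr_ge0 ?invr_ge0 ?exprn_ge0 // ltW. Qed.

(** The row vector is the value at 0 of [H^N] on the basis; at time 0 it is the
    first coordinate vector, as all basis elements but the first vanish at 0. *)
Lemma lower_bound_of_subeigenvector (psi : nat -> R) (M n1 : nat) (L : R) :
  0 <= L -> (forall n, 0 <= psi n) -> (forall n, (M <= n)%N -> psi n = 0) ->
  0 < psi n1 ->
  (forall n, L * psi n <=
     up_rate n * psi n.+1 + stay_rate n * psi n + hole_down q al ga n * psi n.-1) ->
  exists c k, 0 < c /\
    forall N, c * L ^+ N <= (iter (k + N) (transfer q al ga x) 1).[0].
Proof.
move=> L_ge0 psi_ge0 psi_supp psi_n1 psiL.
pose r N n := (iter N (transfer q al ga x) (falling q n)).[0].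
have r0 n : r 0%N n = (n == 0%N)%:R.
  case: n => [|n]; rewrite /r /falling /= ?big_ord0 ?hornerC //.
  by rewrite big_ord_recl !(hornerD, hornerM, hornerN, hornerX, hornerC) qint0 subr0 mul0r.
have falling0 : falling q 0 = 1 by rewrite /falling big_ord0.
rewrite -falling0.
apply: (@tridiagonal_growth R up_rate stay_rate (hole_down q al ga) psi r M n1) => //.
- by move=> n; apply: lt_le_trans (up_rate_ge n).
- by move=> n; rewrite ltr_wpDr ?hole_diag_gt0 // mulr_ge0 ?qint_ge0 // ltW.
- exact: hole_down_gt0.
- by rewrite r0 eqxx.
- by move=> n; rewrite r0 ler0n.
- move=> N n; rewrite /r iterSr transfer_falling -addrA iter_transferP.
  rewrite -[X in iter N _ (_ + X)]addr0.
  rewrite hornerD hornerZ -addrA.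
  rewrite iter_transferP iter_transferP.
  have -> : iter N (transfer q al ga x) 0 = 0.
    have := iter_transferP q al ga x N (-1) 0 0.
    by rewrite scaler0 addr0 scaleN1r addNr.
  by rewrite addr0 !(hornerD, hornerZ).
Qed.

Section LowDensity.
Variable v : R.
Hypothesis v_gt0 : 0 < v.
Hypothesis left_v : (al * v - ga) * (1 + v) = (1 - q) * v.
Hypothesis low : x < v ^+ 2.
Local Notation X0 := (fugacity q v).

(** For [v = C] the inequality of [hole_eval_le] is an equality: the evaluation
    at [X0] is a left eigenvector of [H]. *)
Lemma hole_eval_eq f : (hole q al ga f).[X0] = v * X0 * f.[X0].
Proof.
have X0E := fugacityE q_lt1 v_gt0.
elim/(@poly_monomial_ind R): f => [|n|c f g IHf IHg].
- by rewrite linear0 horner0 mulr0.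
- rewrite /hole extend_linearXn hornerXn; elim: n => [|n IHn] /=.
    rewrite !(hornerD, hornerZ, hornerX, hornerC) expr0 mulr1.
    have h : 1 = (al * v - ga) * X0.
      have X0_def : X0 = (1 + v) / (v * (1 - q)) by rewrite /fugacity -lock.
      rewrite X0_def mulrA left_v [(1 - q) * v]mulrC mulfV //.
      by rewrite mulf_neq0 ?gt_eqF // subr_gt0.
    apply: (mulfI (lt0r_neq0 al_gt0)); rewrite mulrDr mulfV ?gt_eqF //.
    rewrite mulrA [al * (ga / al)]mulrC divfK ?gt_eqF //.
    by rewrite [X in _ + X]h; ring.
  rewrite !(hornerD, hornerZ, hornerM, hornerX, hornerC, hornerXn) IHn !exprS.
  have := congr1 ( *%R (X0 * X0 ^+ n)) X0E; lra.
- rewrite linearP !(hornerD, hornerZ) IHf IHg mulrDr; congr (_ + _).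
  by rewrite mulrCA.
Qed.

Lemma transfer_eval_eq f : (transfer q al ga x f).[X0] = growth q v x * f.[X0].
Proof.
rewrite /transfer !(hornerD, hornerZ, hornerM, hornerX) hole_eval_eq.
by rewrite growthE // mulrDl -[x * X0 * _]mulrA.
Qed.

Lemma falling_eval_gt0 n : 0 < (falling q n).[X0].
Proof.
elim: n => [|n IHn]; first by rewrite /falling big_ord0 hornerC.
rewrite fallingS hornerM mulr_gt0 // !(hornerD, hornerN, hornerX, hornerC).
have X0E := fugacityE q_lt1 v_gt0.
have q1 : 0 < 1 - q by rewrite subr_gt0.
rewrite -(pmulr_rgt0 _ q1) mulrBr qint_closed.
have -> : (1 - q) * X0 = v^-1 + 1.
  by apply: (mulfI (lt0r_neq0 v_gt0)); rewrite mulrA X0E mulrDr mulfV ?gt_eqF ?mulr1.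
have : 0 < v^-1 by rewrite invr_gt0.
have : 0 < q ^+ n by rewrite exprn_gt0.
lra.
Qed.

(** Far from the origin the weight of a step to the right tends to
    [x / v ^+ 2 < 1] times that of a step to the left, both being measured with
    the eigenvector. *)
Lemma low_density_drift : exists2 n0, (0 < n0)%N & forall n, (n0 <= n)%N ->
  up_rate n * (falling q n.+1).[X0] <= hole_down q al ga n * (falling q n.-1).[X0].
Proof.
have q1 : 0 < 1 - q by rewrite subr_gt0.
pose w := v^-1; pose g := ga / al.
have w_gt0 : 0 < w by rewrite invr_gt0.
have g_ge0 : 0 <= g by rewrite divr_ge0 // ltW.
have xw : x * w ^+ 2 < 1 by rewrite /w exprVn ltr_pdivrMr ?exprn_gt0 ?mul1r.
(* With [t = q ^+ n] the claim is [(x + g q t) (w + q t) (w + t) <=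
   (1 - q t) (1 - t)].  The left side is at most [x w^2 + (K - 2) t], the right
   side at least [1 - 2 t]. *)
pose K := x * (2 * w + 1) + g * (w ^+ 2 + 2 * w + 1) + 2.
have K_gt0 : 0 < K.
  have h1 : 0 <= x * w by rewrite mulr_ge0 // ltW.
  have h2 : 0 <= g * w ^+ 2 by rewrite mulr_ge0 // exprn_ge0 // ltW.
  have h3 : 0 <= g * w by rewrite mulr_ge0 // ltW.
  by rewrite /K; have := x_gt0; lra.
pose t0 := Num.min 1 ((1 - x * w ^+ 2) / K).
have t0_gt0 : 0 < t0 by rewrite lt_min ltr01 divr_gt0 // subr_gt0.
have [n0 small] := geometric_small t0_gt0.
exists n0.+1 => // -[|n] //; rewrite ltnS => le_n /=.
have := small n le_n; rewrite le_min => /andP[t_le1 t_leK].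
set t := q ^+ n in t_le1 t_leK *; have t_ge0 : 0 <= t by rewrite exprn_ge0 // ltW.
have l_gt0 := falling_eval_gt0 n.
rewrite !fallingS !hornerM !mulrA ler_pM2r //.
rewrite !(hornerD, hornerN, hornerX, hornerC).
have X0E := fugacityE q_lt1 v_gt0.
have X0w : (1 - q) * X0 = w + 1.
  by apply: (mulfI (lt0r_neq0 v_gt0)); rewrite mulrA X0E mulrDr mulfV ?gt_eqF ?mulr1.
apply: le_trans (hole_down_ge q_gt0 al_gt0 ga_ge0 n).
have qn1 := qint_closed q n.+1; have qn := qint_closed q n.
rewrite -(ler_pM2l (mulr_gt0 q1 q1)).
have -> : (1 - q) * (1 - q) * (up_rate n.+1 * (X0 - qint q n.+1) * (X0 - qint q n)) =
  up_rate n.+1 * ((1 - q) * X0 - (1 - q) * qint q n.+1) *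
    ((1 - q) * X0 - (1 - q) * qint q n) by ring.
have -> : (1 - q) * (1 - q) * (qint q n.+1 * qint q n) =
  ((1 - q) * qint q n.+1) * ((1 - q) * qint q n) by ring.
rewrite X0w qn1 qn /up_rate exprS -/t -/g.
have qt_le : q * t <= t by rewrite ler_piMl // ltW.
have qt_ge0 : 0 <= q * t by rewrite mulr_ge0 // ltW.
rewrite ler_pdivlMr // in t_leK.
have -> : w + 1 - (1 - q * t) = w + q * t by ring.
have -> : w + 1 - (1 - t) = w + t by ring.
have bound : (x + g * (q * t)) * (w + q * t) * (w + t) <= (x + g * t) * (w + t) * (w + t).
  apply: ler_wpM2r; first by rewrite addr_ge0 // ltW.
  apply: ler_pM.
  - by rewrite addr_ge0 ?(ltW x_gt0) // mulr_ge0.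
  - by rewrite addr_ge0 ?(ltW w_gt0).
  - by rewrite lerD2l ler_wpM2l.
  - by rewrite lerD2l.
apply: (le_trans bound).
have step : (1 - t) * (1 - t) <= (1 - q * t) * (1 - t).
  by apply: ler_wpM2r; rewrite ?subr_ge0 // lerD2l lerN2.
apply: le_trans step.
have tt : t * t <= t by rewrite ler_piMl.
have ttt : t * (t * t) <= t by exact: (le_trans (ler_wpM2l t_ge0 tt) tt).
have xt : x * (t * t) <= x * t by rewrite ler_wpM2l // ltW.
have gwt : g * (w * (t * t)) <= g * (w * t) by rewrite ler_wpM2l // ler_wpM2l // ltW.
have gt3 : g * (t * (t * t)) <= g * t by rewrite ler_wpM2l.
have tt_ge0 : 0 <= t * t by rewrite mulr_ge0.
rewrite /K in t_leK; lra.
Qed.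

(** Multiply the eigenvector by the cutoff [M - n].  Where the drift is to the
    left this only helps; on the remaining sites, whose number [n0] does not
    depend on [M], the relative loss is of order [1 / M]. *)
Lemma low_density_lower_bound L : 0 <= L -> L < growth q v x ->
  exists c k, 0 < c /\
    forall N, c * L ^+ N <= (iter (k + N) (transfer q al ga x) 1).[0].
Proof.
move=> L_ge0 L_lt; have [n0 n0_gt0 drift] := low_density_drift.
pose ell n := (falling q n).[X0].
pose K := (x + ga / al) * X0 / (growth q v x - L).
have [M0 M0_ge] : exists M0 : nat, K <= M0%:R.
  by exists (Num.bound `|K|); apply/(le_trans (ler_norm K))/ltW/archi_boundP.
pose M := (n0 + M0).+1.
apply: (@lower_bound_of_subeigenvector (fun n => ell n * (M - n)%:R) M 0) => //.
- by move=> n; rewrite mulr_ge0 // ltW // falling_eval_gt0.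
- by move=> n le_n; rewrite (eqP (_ : (M - n)%N == 0%N)) ?mulr0 // subn_eq0.
- by rewrite mulr_gt0 ?falling_eval_gt0.
move=> n; have ell_gt0 k : 0 < ell k by apply: falling_eval_gt0.
have upS k : 0 < up_rate k by apply: lt_le_trans (up_rate_ge k).
have stay_ge0 k : 0 <= stay_rate k.
  by rewrite addr_ge0 ?mulr_ge0 ?qint_ge0 ?(ltW x_gt0) // ltW // hole_diag_gt0.
have down_ge0 k : 0 <= hole_down q al ga k.
  by case: k => [|k] //; apply/ltW/hole_down_gt0.
have [le_Mn|lt_nM] := leqP M n.
  have psi_ge0 k : 0 <= ell k * (M - k)%:R by rewrite mulr_ge0 // ltW.
  apply: (@le_trans _ _ 0).
    by rewrite (eqP (_ : (M - n)%N == 0%N)) ?subn_eq0 // !mulr0.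
  by rewrite addr_ge0 ?addr_ge0 // mulr_ge0 // ltW.
have eigen : up_rate n * ell n.+1 + stay_rate n * ell n + hole_down q al ga n * ell n.-1 =
    growth q v x * ell n.
  by rewrite -transfer_eval_eq transfer_falling !(hornerD, hornerZ).
have MnS : (M - n.+1)%:R = (M - n)%:R - 1 :> R.
  by rewrite subnS -subn1 natrB // subn_gt0.
have Mnp : hole_down q al ga n * (ell n.-1 * (M - n.-1)%:R) =
    hole_down q al ga n * ell n.-1 * ((M - n)%:R + 1).
  case: n lt_nM {eigen MnS} => [|n] lt_nM; first by rewrite /= !mul0r.
  by rewrite /= mulrA subnS natr1 prednK // subn_gt0 ltnW.
rewrite MnS Mnp.
suff : up_rate n * ell n.+1 <= (growth q v x - L) * ((M - n)%:R * ell n) +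
    hole_down q al ga n * ell n.-1.
  have := congr1 ( *%R (M - n)%:R) eigen; lra.
have [le_n|lt_n] := leqP n0 n.
  rewrite ler_wpDl ?drift // !mulr_ge0 ?subr_ge0 ?(ltW L_lt) //; exact/ltW/ell_gt0.
rewrite ler_wpDr ?mulr_ge0 ?down_ge0 ?(ltW (ell_gt0 _)) //.
have ellS : ell n.+1 <= X0 * ell n.
  rewrite /ell fallingS hornerM ler_wpM2r ?(ltW (ell_gt0 _)) //.
  by rewrite !(hornerD, hornerN, hornerX, hornerC) gerBl qint_ge0.
have up_le : up_rate n <= x + ga / al.
  rewrite lerD2l ler_piMr ?divr_ge0 ?(ltW al_gt0) // exprn_ile1 // ltW //.
have X0_gt0 := fugacity_gt0 q_lt1 v_gt0.
apply: (@le_trans _ _ ((x + ga / al) * (X0 * ell n))).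
  by apply: ler_pM => //; apply: ltW; rewrite ?ell_gt0.
rewrite !mulrA ler_wpM2r ?(ltW (ell_gt0 _)) // [leRHS]mulrC -ler_pdivrMr ?subr_gt0 //.
rewrite -/K; apply: (le_trans M0_ge); rewrite ler_nat.
by rewrite leq_subRL ?(ltnW lt_nM) // leqW // leq_add2r ltnW.
Qed.

End LowDensity.

(** Beyond a site [n0] the matrix is close to the Toeplitz matrix with symbol
    [(1 + x + v (z + 1 / z)) / (1 - q)] after conjugation by powers of
    [v * (1 - q)].  A parabola on an interval of length [M] has second difference
    -2 and is at least [M - 1] inside, so it is a sub-eigenvector of
    [z + 1 / z] with eigenvalue close to 2. *)
Lemma max_current_lower_bound (v L : R) : 0 < v -> x = v ^+ 2 -> 0 <= L -> L < growth q v x ->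
  exists c k, 0 < c /\
    forall N, c * L ^+ N <= (iter (k + N) (transfer q al ga x) 1).[0].
Proof.
move=> v_gt0 xE L_ge0 L_lt.
have q1 : 0 < 1 - q by rewrite subr_gt0.
have growth_v : growth q v x = (1 + v) ^+ 2 / (1 - q).
  by rewrite /growth xE expr2 mulfK ?gt_eqF.
move: growth_v L_lt; move: (growth q v x) => G GE L_lt.
have lam_gt0 : 0 < G by apply: le_lt_trans L_lt.
(* [L = (1 - 3 e) G] leaves room for three factors [1 - e]: two come from the
   entries of the matrix and one from the parabola *)
pose e := (G - L) / (3 * G).
have e_gt0 : 0 < e by rewrite divr_gt0 ?subr_gt0 ?mulr_gt0.
have e_lam : 3 * (e * G) = G - L.
  by rewrite mulrCA /e divfK // gt_eqF // mulr_gt0.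
have e_le1 : e <= 1 by rewrite ler_pdivrMr ?mulr_gt0 // mul1r; lra.
have [n0 small] := geometric_small e_gt0.
pose K := 2 * v / (e * (1 + v) ^+ 2).
have [m m_ge] : exists m : nat, K <= m%:R.
  by exists (Num.bound `|K|); apply/(le_trans (ler_norm K))/ltW/archi_boundP.
have m_K : 2 * v <= e * (1 + v) ^+ 2 * m.+1%:R.
  have : 0 < e * (1 + v) ^+ 2 by rewrite mulr_gt0 ?exprn_gt0 ?addr_gt0.
  move=> h; rewrite [leRHS]mulrC -ler_pdivrMr //; apply: (le_trans m_ge).
  by rewrite ler_nat.
pose M := m.+2.
pose w n : R := ((n - n0.+1) * (M - (n - n0.+1)))%:R.
have w_ge0 n : 0 <= w n by rewrite ler0n.
pose z := v * (1 - q); have z_gt0 : 0 < z by rewrite mulr_gt0.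
have zX_gt0 n : 0 < z ^- n by rewrite invr_gt0 exprn_gt0.
have upS k : 0 < up_rate k by apply: lt_le_trans (up_rate_ge k).
have stay_ge0 k : 0 <= stay_rate k.
  by rewrite addr_ge0 ?mulr_ge0 ?qint_ge0 ?(ltW x_gt0) // ltW // hole_diag_gt0.
have down_ge0 k : 0 <= hole_down q al ga k.
  by case: k => [|k] //; apply/ltW/hole_down_gt0.
apply: (@lower_bound_of_subeigenvector (fun n => z ^- n * w n) (n0.+1 + M) n0.+2) => //.
- by move=> n; rewrite mulr_ge0 // ltW.
- move=> n le_n; rewrite /w (eqP (_ : (M - (n - n0.+1))%N == 0%N)) ?muln0 ?mulr0 //.
  by rewrite subn_eq0 leq_subRL // (leq_trans _ le_n) // leq_addr.
- by rewrite mulr_gt0 // ltr0n /w subSnn mul1n.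
move=> n; have psi_ge0 k : 0 <= z ^- k * w k by rewrite mulr_ge0 // ltW.
have [w0|w_neq0] := eqVneq (w n) 0.
  rewrite w0 !mulr0 addr0 addr_ge0 // mulr_ge0 //; exact: ltW.
have [k nE k_lt] : exists2 k, n = (n0.+1 + k.+1)%N & (k.+1 < M)%N.
  move: w_neq0; rewrite pnatr_eq0 muln_eq0 negb_or !subn_eq0 -!ltnNge => /andP[lt1 lt2].
  by exists (n - n0.+2)%N; rewrite -subSn ?subSS // subnKC // ltnW.
have wE j : (j <= M)%N -> w (n0.+1 + j)%N = j%:R * (M%:R - j%:R).
  by move=> le_j; rewrite /w addKn natrM natrB.
have wn : w n = (k%:R + 1) * (M%:R - (k%:R + 1)) by rewrite nE wE ?natr1 // ltnW.
have wnS : w n.+1 = (k%:R + 2) * (M%:R - (k%:R + 2)).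
  by rewrite nE -addnS wE // -addn2 natrD.
have wnp : w n.-1 = k%:R * (M%:R - k%:R) by rewrite nE addnS /= wE // ltnW // ltnW.
set t := q ^+ n.-1; have t_ge0 : 0 <= t by rewrite exprn_ge0 // ltW.
have t_le : t <= e by apply: small; rewrite nE addnS /= addSnnS leq_addr.
have qint_n : 1 - t <= (1 - q) * qint q n.
  rewrite qint_closed lerD2l lerN2 /t nE addnS /= exprS ler_piMl ?exprn_ge0 //; exact: ltW.
have qint_np : (1 - q) * qint q n.-1 = 1 - t by rewrite qint_closed.
have n_gt0 : n = n.-1.+1 by rewrite nE addnS.
have t_le1 : t <= 1 by apply: le_trans e_le1.
have zM : z ^- n.+1 = z ^- n.-1 / z / z.
  by rewrite {1}n_gt0 !exprSr !invfM.
have zN : z ^- n = z ^- n.-1 / z by rewrite {1}n_gt0 exprSr invfM.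
have zp_gt0 := zX_gt0 n.-1.
rewrite zM zN; move: (z ^- n.-1) zp_gt0 => y y_gt0.
have wn_ge : m.+1%:R <= w n.
  have Mk : k%:R + 1 + 1 <= M%:R :> R by rewrite !natr1 ler_nat.
  have Mm : M%:R = m.+1%:R + 1 :> R by rewrite natr1.
  have h : 0 <= M%:R - (k%:R + 1) - 1 :> R by lra.
  have := mulr_ge0 (ler0n R k) h; rewrite wn; lra.
have w_sum : w n.+1 + w n.-1 = 2 * w n - 2 by rewrite wnS wnp wn; ring.
have GE' : (1 - q) * G = (1 + v) ^+ 2 by rewrite GE mulrC divfK // gt_eqF.
have sq_ge0 : 0 <= (1 + v) ^+ 2 by rewrite exprn_ge0 // addr_ge0 // ltW.
have s_ge0 : 0 <= 1 - t by rewrite subr_ge0.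
have up_z : v <= (1 - q) * (up_rate n / z).
  rewrite mulrA ler_pdivlMr // mulrC [(1 - q) * _]mulrC /z mulrAC.
  by apply: ler_wpM2r; [exact: ltW | rewrite -expr2 -xE up_rate_ge].
have stay_z : (1 + v ^+ 2) * (1 - t) <= (1 - q) * stay_rate n.
  rewrite -xE /stay_rate.
  have -> : (1 - q) * (hole_diag q al ga n + x * qint q n) =
    (1 - q) * hole_diag q al ga n + x * ((1 - q) * qint q n) by ring.
  have -> : (1 + x) * (1 - t) = (1 - t) + x * (1 - t) by ring.
  apply: lerD; last by apply: ler_wpM2l; [exact: ltW |].
  apply: (le_trans qint_n); apply: ler_wpM2l; [exact: ltW | exact: hole_diag_ge].
have down_z : v * (1 - t) ^+ 2 <= (1 - q) * (hole_down q al ga n * z).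
  have -> : (1 - q) * (hole_down q al ga n * z) =
    v * ((1 - q) * (1 - q) * hole_down q al ga n) by rewrite /z; ring.
  apply: ler_wpM2l; first exact: ltW.
  have := hole_down_ge q_gt0 al_gt0 ga_ge0 n.-1; rewrite -n_gt0 => le_down.
  have q2 : 0 <= (1 - q) * (1 - q) by rewrite mulr_ge0 // ltW.
  apply: le_trans (ler_wpM2l q2 le_down).
  have -> : (1 - q) * (1 - q) * (qint q n * qint q n.-1) =
    ((1 - q) * qint q n) * ((1 - q) * qint q n.-1) by ring.
  by rewrite qint_np expr2; apply: ler_wpM2r.
have sq_le : (1 - t) ^+ 2 <= 1 - t by rewrite expr2 ler_piMl // gerBl.
have sq_ge : (1 - e) ^+ 2 <= (1 - t) ^+ 2.
  by rewrite ler_sqr ?nnegrE ?subr_ge0 // lerD2l lerN2.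
have stay_z' : (1 + v ^+ 2) * (1 - t) ^+ 2 <= (1 - q) * stay_rate n.
  by apply: le_trans stay_z; apply: ler_wpM2l; rewrite // addr_ge0 // exprn_ge0 // ltW.
have up_z' : v * (1 - t) ^+ 2 <= (1 - q) * (up_rate n / z).
  by apply: le_trans up_z; rewrite ler_piMr ?(ltW v_gt0) // (le_trans sq_le) // gerBl.
have target : (1 - q) * L * w n <= (1 - q) * (up_rate n / z) * w n.+1
    + (1 - q) * stay_rate n * w n + (1 - q) * (hole_down q al ga n * z) * w n.-1.
  have lower : (1 - t) ^+ 2 * ((1 + v) ^+ 2 * w n - 2 * v) <=
    (1 - q) * (up_rate n / z) * w n.+1 + (1 - q) * stay_rate n * w n +
    (1 - q) * (hole_down q al ga n * z) * w n.-1.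
    have -> : (1 - t) ^+ 2 * ((1 + v) ^+ 2 * w n - 2 * v) =
      v * (1 - t) ^+ 2 * w n.+1 + (1 + v ^+ 2) * (1 - t) ^+ 2 * w n
      + v * (1 - t) ^+ 2 * w n.-1.
      have := congr1 ( *%R (v * (1 - t) ^+ 2)) w_sum; lra.
    by rewrite !lerD // ler_wpM2r.
  apply: le_trans lower.
  have mid : (1 - e) * ((1 + v) ^+ 2 * w n) <= (1 + v) ^+ 2 * w n - 2 * v.
    have es_ge0 : 0 <= e * (1 + v) ^+ 2 by rewrite mulr_ge0 // ltW.
    have := le_trans m_K (ler_wpM2l es_ge0 wn_ge); lra.
  have sw_ge0 : 0 <= (1 + v) ^+ 2 * w n by rewrite mulr_ge0.
  have e1_ge0 : 0 <= 1 - e by rewrite subr_ge0.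
  have e2_ge0 : 0 <= (1 - t) ^+ 2 by rewrite exprn_ge0.
  apply: le_trans (ler_wpM2l e2_ge0 mid).
  have := ler_wpM2r (mulr_ge0 e1_ge0 sw_ge0) sq_ge.
  apply: le_trans.
  have -> : (1 - q) * L * w n = (1 - 3 * e) * ((1 + v) ^+ 2 * w n).
    rewrite -GE'; have := congr1 ( *%R ((1 - q) * w n)) e_lam; lra.
  rewrite mulrA -exprSr; apply: ler_wpM2r => //.
  have : 0 <= e ^+ 2 * (3 - e).
    by rewrite mulr_ge0 ?exprn_ge0 ?(ltW e_gt0) // subr_ge0 (le_trans e_le1) // ler1n.
  lra.
have yz_gt0 : 0 < y / z / (1 - q) by rewrite !divr_gt0.
have := ler_wpM2l (ltW yz_gt0) target.
have -> : y / z / (1 - q) * ((1 - q) * L * w n) = L * (y / z * w n).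
  by field; rewrite !gt_eqF.
congr (_ <= _); field; rewrite !gt_eqF //.
Qed.

End LowerBound.

(** * The chain on horizontal paths *)

Section Geometry.
Context (N : nat).

Lemma shift_horizontal_path y :
  shift_path 1 (horizontal_path N y) = horizontal_path N y.+1.
Proof.
rewrite /shift_path /horizontal_path -map_comp; apply: eq_map => i /=.
by rewrite !addn1 addSn.
Qed.

Lemma strictly_above_horizontal y x k : (k <= x <= k + N)%N ->
  strictly_above (horizontal_path N y) (x, k) = (y < k)%N.
Proof.
move=> /andP[le_kx le_xN]; apply/hasP/idP => [[u] /mapP[i _ ->] /= /andP[] //|lt_yk].
exists ((y + (x - k))%N, y); last by rewrite /= addKn eqxx.
by apply/mapP; exists (x - k)%N; rewrite ?mem_iota //= add0n ltnS leq_subLR.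
Qed.

Lemma vertices_between_horizontal y :
  vertices_between N (horizontal_path N y) (horizontal_path N y.+1) =
  horizontal_path N y.+1.
Proof.
have rowE k : [seq v <- [seq (x, k) | x <- iota k N.+1] |
    strictly_above (horizontal_path N y) v && ~~ strictly_above (horizontal_path N y.+1) v] =
    if k == y.+1 then [seq (x, k) | x <- iota k N.+1] else [::].
  rewrite filter_map (@eq_in_filter _ _ (fun=> k == y.+1)) => [|x].
    by case: ifP => _; rewrite ?filter_predT ?filter_pred0.
  rewrite mem_iota addnS ltnS => x_in.
  rewrite -[LHS]/(strictly_above _ (x, k) && ~~ strictly_above _ (x, k)).
  by rewrite !strictly_above_horizontal //; apply/idP/eqP; lia.
pose row k := if k == y.+1 then [seq (x, k) | x <- iota k N.+1] else [::].
have lower_rows s : y.+1 \notin s -> flatten [seq row k | k <- s] = [::].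
  elim: s => // k s IHs; rewrite in_cons negb_or eq_sym => /andP[neq_k /IHs] IH.
  by rewrite /= IH /row (negPf neq_k).
rewrite /vertices_between filter_flatten -map_comp (eq_map rowE).
rewrite [(head _ _).2]/= -[y.+2]addn1 iotaD map_cat flatten_cat lower_rows.
  rewrite cat0s; transitivity (row y.+1 ++ [::]); first by [].
  rewrite cats0 /row eqxx /horizontal_path.
  by rewrite -[X in iota X](addn0 y.+1) iotaDl -map_comp.
by rewrite mem_iota add0n ltnn.
Qed.

Lemma outgoing_edges_horizontal k :
  outgoing_edges N (horizontal_path N k) =
  [seq top_edge ((k + i)%N, k) | i <- iota 1 N].
Proof.
rewrite /outgoing_edges filter_flatten -map_comp.
rewrite {2}/horizontal_path -map_comp.
have edgesE i : i \in iota 0 N.+1 ->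
  [seq e <- [:: top_edge ((k + i)%N, k); right_edge ((k + i)%N, k)] |
     (e.2 \in strip N) && (e.2 \notin horizontal_path N k)] =
  if (0 < i)%N then [:: top_edge ((k + i)%N, k)] else [::].
  rewrite mem_iota add0n ltnS => /andP[_ le_iN] /=.
  have -> : ((k + i)%N, k.+1) \in horizontal_path N k = false.
    by apply/mapP => -[j _ []]; lia.
  have -> : (((k + i).+1, k) \in horizontal_path N k) = (i < N)%N.
    apply/mapP/idP => [[j]|lt_iN].
      by rewrite mem_iota => lt_j []; lia.
    by exists i.+1; rewrite ?addnS // mem_iota.
  rewrite !inE /=.
  have -> : (k < k + i <= k.+1 + N)%N = (0 < i)%N by lia.
  have -> : (k <= (k + i).+1 <= k + N)%N && ~~ (i < N)%N = false by lia.
  by rewrite andbT.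
rewrite (_ : map _ _ = [seq (if (0 < i)%N then [:: top_edge ((k + i)%N, k)] else [::])
  | i <- iota 0 N.+1]); last exact/eq_in_map.
have flattenE j n : flatten [seq (if (0 < i)%N then [:: top_edge ((k + i)%N, k)] else [::])
  | i <- iota j.+1 n] = [seq top_edge ((k + i)%N, k) | i <- iota j.+1 n].
  by elim: n j => //= n IHn j; rewrite IHn.
by rewrite /= flattenE.
Qed.

End Geometry.

Section RowToRow.
Context {R : realFieldType} (p : params R).

Definition left_weight (b r : bool) : R :=
  coin_weight (if b then 1 - par_c p else par_a p) r.

Definition right_weight (l t : bool) : R :=
  coin_weight (if l then 1 - par_b p else par_d p) t.

Definition bulk_weight (l b t r : bool) : R :=
  match l, b with
  | true, true => (t && r)%:R
  | false, false => (~~ t && ~~ r)%:R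
  | true, false => (t != r)%:R * coin_weight (theta2 p) r
  | false, true => (t != r)%:R * coin_weight (theta1 p) t
  end.

(** Expectation of [F] of the top edges of a row of vertices, given the state
    [h] of the edge entering from the left, the states [bs] of the bottom edges
    that remain, and the top edges [acc] already sampled; the last vertex is the
    right boundary vertex. *)
Fixpoint row_mean (F : seq bool -> R) (h : bool) (bs acc : seq bool) : R :=
  if bs is b :: bs' then
    \sum_(t : bool) \sum_(r : bool)
      bulk_weight h b t r * row_mean F r bs' (rcons acc t)
  else \sum_(t : bool) right_weight h t * F (rcons acc t).

Definition word_mean (F : seq bool -> R) (w : seq bool) : R :=
  \sum_(r : bool) left_weight (head false w) r * row_mean F r (behead w) [::].

Local Notation vert z i := (((z + i)%N, z) : vertex).

Definition visit (s : config) (v : vertex) (t r : bool) : config :=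
  [eta s with top_edge v |-> t, right_edge v |-> r].

Lemma sample_cons N v vs f s :
  sample p N (v :: vs) f s = \sum_(t : bool) \sum_(r : bool)
    vertex_weight p N v (s (left_edge v)) (s (bottom_edge v)) t r *
    sample p N vs f (visit s v t r).
Proof. by []. Qed.

Lemma visit_top s z m t r i :
  visit s (vert z m) t r (top_edge (vert z i)) =
  if i == m then t else s (top_edge (vert z i)).
Proof.
rewrite /visit /= /top_edge /right_edge /= !xpair_eqE /= !eqn_add2l !eqxx !andbT /=.
by rewrite andbb [z.+1 == z]eqn_leq ltnn !andbF.
Qed.

Lemma visit_bottom s y m t r i :
  visit s (vert y.+1 m) t r (bottom_edge (vert y.+1 i)) = s (bottom_edge (vert y.+1 i)).
Proof.
rewrite /visit /= /bottom_edge /top_edge /right_edge /= !xpair_eqE /=.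
by rewrite [y == y.+1]eqn_leq ltnn !andbF.
Qed.

Lemma visit_left s z m t r :
  visit s (vert z m) t r (left_edge (vert z m.+1)) = r.
Proof.
rewrite /visit /= /left_edge /top_edge /right_edge /= !xpair_eqE /= addnS /= !eqxx /=.
by rewrite [(z + m).+1 == _]eqn_leq ltnn.
Qed.

(** Sampling a row only looks at its bottom edges and at the horizontal edge
    just sampled; the vertices to the left matter only through the top edges that
    [F] records. *)
Lemma sample_row (y N j k : nat) (F : seq bool -> R) (f : config -> R) (s : config) :
  (forall s, f s = F [seq s (top_edge (vert y.+1 i)) | i <- iota 1 N]) ->
  (j.+1 + k)%N = N ->
  sample p N [seq vert y.+1 i | i <- iota j.+1 k.+1] f s =
  row_mean F (s (left_edge (vert y.+1 j.+1)))
    [seq s (bottom_edge (vert y.+1 i)) | i <- iota j.+1 k]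
    [seq s (top_edge (vert y.+1 i)) | i <- iota 1 j].
Proof.
move=> fE; elim: k j s => [|k IHk] j s jkN.
  rewrite addn0 in jkN; rewrite [LHS]/= [RHS]/=; apply: eq_bigr => t _.
  rewrite /vertex_weight /is_left_boundary /is_right_boundary /= jkN eqxx.
  rewrite -[X in _ == X]addn0 eqn_add2l -{1}jkN /= big_bool /= !mul0r add0r mul1r.
  congr (_ * _); rewrite fE -/(visit _ _ _ _) -jkN -[X in iota 1 X]addn1 iotaD map_cat cats1.
  congr (F (rcons _ _)); last by rewrite add1n visit_top eqxx.
  apply/eq_in_map => i; rewrite mem_iota add1n ltnS => /andP[_ le_i].
  by rewrite visit_top ltn_eqF // ltnS.
have iotaS m n : iota m n.+1 = m :: iota m.+1 n by [].
rewrite [iota j.+1 k.+2]iotaS [iota j.+1 k.+1]iotaS !map_cons sample_cons.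
rewrite [RHS]/=; apply: eq_bigr => t _; apply: eq_bigr => r _.
rewrite (IHk j.+1) ?visit_left; last by rewrite addSnnS.
have -> : vertex_weight p N (vert y.+1 j.+1) =
  fun l b t r => bulk_weight l b t r.
  rewrite /vertex_weight /is_left_boundary /is_right_boundary /=.
  by rewrite -[X in _ == X]addn0 !eqn_add2l /= -jkN ltn_eqF // addnS ltnS leq_addr.
congr (_ * row_mean _ _ _ _).
  by apply/eq_in_map => i _; rewrite visit_bottom.
rewrite -[X in iota 1 X]addn1 iotaD map_cat cats1.
congr rcons; last by rewrite add1n visit_top eqxx.
apply/eq_in_map => i; rewrite mem_iota add1n ltnS => /andP[_ le_i].
by rewrite visit_top ltn_eqF // ltnS.
Qed.

Lemma transition_row_mean (y n : nat) (tau tau' : n.+1.-tuple bool) :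
  transition p (horizontal_path n.+1 y) (shift_path 1 (horizontal_path n.+1 y)) tau tau' =
  word_mean (fun w => (w == tau')%:R) tau.
Proof.
rewrite /transition shift_horizontal_path vertices_between_horizontal.
set F := fun w : seq bool => _.
have outE s : outgoing_config n.+1 (horizontal_path n.+1 y.+1) s =
    [seq s (top_edge (vert y.+1 i)) | i <- iota 1 n.+1].
  by rewrite /outgoing_config outgoing_edges_horizontal -map_comp.
set f := fun s : config => _.
have fE s : f s = F [seq s (top_edge (vert y.+1 i)) | i <- iota 1 n.+1].
  by rewrite /f outE.
set s0 := init_config _ _.
have s0E i : (i < n.+1)%N -> s0 (bottom_edge (vert y.+1 i)) = nth false tau i.
  move=> lt_i; rewrite /s0 /init_config outgoing_edges_horizontal.
  have -> : bottom_edge (vert y.+1 i) = top_edge (vert y i.+1).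
    by rewrite /bottom_edge /top_edge /= addnS addSn.
  rewrite (@index_map _ _ (fun j => top_edge (vert y j))); last first.
    by move=> i1 i2 /(congr1 (fun e : edge => e.1.1)) /addnI.
  congr nth; have := @index_uniq _ 0%N i (iota 1 n.+1).
  by rewrite size_iota nth_iota // add1n iota_uniq => ->.
have -> : horizontal_path n.+1 y.+1 =
  vert y.+1 0 :: [seq vert y.+1 i | i <- iota 1 n.+1] by [].
rewrite sample_cons /word_mean exchange_big; apply: eq_bigr => r _.
have leftE l b t : vertex_weight p n.+1 (vert y.+1 0) l b t r =
    (~~ t)%:R * left_weight b r.
  by rewrite /vertex_weight /is_left_boundary /= addn0 eqxx.
rewrite big_bool !leftE -[(~~ true)%:R]/(0 : R) -[(~~ false)%:R]/(1 : R).
rewrite -[LHS]/(_ + _) !mul0r add0r mul1r (sample_row _ fE) // visit_left s0E //.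
rewrite nth0; congr (_ * row_mean _ _ _ _).
apply: (@eq_from_nth _ false) => [|i].
  by rewrite size_map size_iota size_behead size_tuple.
rewrite size_map size_iota => lt_i.
by rewrite (nth_map 0%N) ?size_iota // nth_iota // visit_bottom s0E // nth_behead.
Qed.

Definition stochastic_rates : Prop :=
  [/\ 0 < par_a p < 1, 0 < par_b p < 1, 0 < par_c p < 1, 0 < par_d p < 1
    & 0 < theta1 p < 1 /\ 0 < theta2 p < 1].

Section Stochastic.
Hypothesis rates : stochastic_rates.

Lemma left_weight_gt0 b r : 0 < left_weight b r.
Proof.
have [/andP[a0 a1] _ /andP[c0 c1] _ _] := rates.
by case: b r => [] []; rewrite /left_weight /coin_weight; lra.
Qed.

Lemma right_weight_gt0 b r : 0 < right_weight b r.
Proof.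
have [_ /andP[a0 a1] _ /andP[c0 c1] _] := rates.
by case: b r => [] []; rewrite /right_weight /coin_weight; lra.
Qed.

Lemma bulk_weight_ge0 l b t r : 0 <= bulk_weight l b t r.
Proof.
have [_ _ _ _ [/andP[a0 a1] /andP[c0 c1]]] := rates.
by case: l b t r => [] [] [] []; rewrite /bulk_weight /coin_weight /=; lra.
Qed.

Lemma row_mean_ge0 F h bs acc :
  (forall w, 0 <= F w) -> 0 <= row_mean F h bs acc.
Proof.
move=> F_ge0; elim: bs h acc => [|b bs IHbs] h acc /=.
  by apply: sumr_ge0 => t _; rewrite mulr_ge0 // ltW // right_weight_gt0.
apply: sumr_ge0 => t _; apply: sumr_ge0 => r _.
by rewrite mulr_ge0 // bulk_weight_ge0.
Qed.

Lemma word_mean_ge0 F w : (forall u, 0 <= F u) -> 0 <= word_mean F w.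
Proof.
move=> F_ge0; apply: sumr_ge0 => r _.
by rewrite mulr_ge0 ?row_mean_ge0 // ltW // left_weight_gt0.
Qed.

Lemma row_mean_cst1 h bs acc : row_mean (fun=> 1) h bs acc = 1.
Proof.
elim: bs h acc => [|b bs IHbs] h acc /=.
  by rewrite big_bool /right_weight /coin_weight /=; case: h; ring.
under eq_bigr do under eq_bigr do rewrite IHbs mulr1.
by rewrite !big_bool /bulk_weight /coin_weight /=; case: h b => [] [] /=; ring.
Qed.

Lemma word_mean_cst1 w : word_mean (fun=> 1) w = 1.
Proof.
rewrite /word_mean; under eq_bigr do rewrite row_mean_cst1 mulr1.
by rewrite big_bool /left_weight /coin_weight /=; case: (head false w); ring.
Qed.

End Stochastic.

End RowToRow.

(** * Uniqueness of the stationary measure *)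

Section UniqueStationary.
Context {R : realFieldType} {T : finType} (P : T -> T -> R) (z : T) (rank : T -> nat).
Hypothesis P_ge0 : forall s t, 0 <= P s t.
Hypothesis P_sum1 : forall s, \sum_t P s t = 1.
Hypothesis descent : forall s, s != z -> exists2 t, 0 < P s t & (rank t < rank s)%N.

(** Mass at [t] would flow, along states of decreasing rank, into [z]. *)
Lemma stationary_vanish (e : T -> R) :
  (forall t, 0 <= e t) -> (forall t, \sum_s e s * P s t = e t) -> e z = 0 ->
  forall t, e t = 0.
Proof.
move=> e_ge0 eP ez t; have [n] := ubnP (rank t); elim: n t => // n IHn t.
rewrite ltnS => le_tn; have [->//|/descent[t' Ptt' lt_t't]] := eqVneq t z.
have et' : e t' = 0 by apply: IHn; apply: leq_trans lt_t't le_tn.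
have := eP t'; rewrite et' => /psumr_eq0P h0.
have /eqP := h0 (fun s _ => mulr_ge0 (e_ge0 s) (P_ge0 s t')) t isT.
by rewrite mulf_eq0 (gt_eqF Ptt') orbF => /eqP.
Qed.

(** The absolute value of a stationary signed measure is stationary, so its
    positive and negative parts are stationary as well, and one of them
    vanishes at [z]. *)
Lemma signed_stationary_eq0 (mu : T -> R) :
  (forall t, \sum_s mu s * P s t = mu t) -> \sum_s mu s = 0 -> forall t, mu t = 0.
Proof.
move=> muP mu0.
have absP t : \sum_s `|mu s| * P s t = `|mu t|.
  have le_abs u : 0 <= \sum_s `|mu s| * P s u - `|mu u|.
    rewrite subr_ge0 -{1}muP; apply: le_trans (ler_norm_sum _ _ _) _.
    by apply: ler_sum => s _; rewrite normrM (ger0_norm (P_ge0 _ _)).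
  apply/eqP; rewrite -subr_eq0; apply/eqP.
  apply: (psumr_eq0P (P := predT) (F := fun u => \sum_s `|mu s| * P s u - `|mu u|)) => //.
  rewrite big_split /= sumrN exchange_big /=.
  under eq_bigr do rewrite -mulr_sumr P_sum1 mulr1.
  by rewrite subrr.
have sumP (c : R) t : \sum_s (`|mu s| + c * mu s) * P s t = `|mu t| + c * mu t.
  rewrite -absP -muP mulr_sumr -big_split /=.
  by apply: eq_bigr => s _; rewrite mulrDl mulrA.
have [mu_z|mu_z] := leP 0 (mu z).
  have h t : `|mu t| + (-1) * mu t = 0.
    apply: (stationary_vanish _ (sumP (-1))) => [s|].
      by rewrite mulN1r subr_ge0 ler_norm.
    by rewrite mulN1r ger0_norm // subrr.
  have mu_ge0 t : 0 <= mu t.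
    by have := h t; rewrite mulN1r => /eqP; rewrite subr_eq0 => /eqP <-.
  by move=> t; apply: (psumr_eq0P (fun s _ => mu_ge0 s) mu0).
have h t : `|mu t| + 1 * mu t = 0.
  apply: (stationary_vanish _ (sumP 1)) => [s|].
    by rewrite mul1r -[mu s in X in _ + X]opprK subr_ge0 -normrN ler_norm.
  by rewrite mul1r ltr0_norm // addNr.
have mu_le0 t : 0 <= - mu t.
  by have := h t; rewrite mul1r => /eqP; rewrite addr_eq0 => /eqP <-.
have opp_sum0 : \sum_t - mu t = 0 by rewrite sumrN mu0 oppr0.
move=> t; apply/eqP; rewrite -oppr_eq0; apply/eqP.
exact: (psumr_eq0P (fun s _ => mu_le0 s) opp_sum0).
Qed.

End UniqueStationary.

(** * The matrix product stationary measure *)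

Section MatrixAnsatz.
Context {R : realFieldType} (p : params R) (psi : seq bool -> R).

Definition matrix_ansatz : Prop :=
  [/\ forall u w, theta2 p * psi (u ++ [:: true, false & w])
        - theta1 p * psi (u ++ [:: false, true & w]) =
        (1 - theta2 p) * psi (u ++ false :: w) + (1 - theta1 p) * psi (u ++ true :: w),
      forall w, par_a p * psi (false :: w) - par_c p * psi (true :: w) = psi w
    & forall w, par_b p * psi (rcons w true) - par_d p * psi (rcons w false) =
        (1 - par_b p - par_d p) * psi w].

Hypothesis ansatz : matrix_ansatz.

(** The weight of a word in which the letter [h] sits on a horizontal edge: the
    operators there are D + 1 and E - 1. *)
Definition horizontal_weight (u : seq bool) (h : bool) (w : seq bool) : R :=
  psi (u ++ h :: w) + (if h then 1 else -1) * psi (u ++ w).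

Lemma bulk_exchange u w t r :
  \sum_(h : bool) \sum_(b : bool)
    horizontal_weight u h (b :: w) * bulk_weight p h b t r =
  horizontal_weight (rcons u t) r w.
Proof.
have [bulk _ _] := ansatz; have := bulk u w.
rewrite !big_bool /= /horizontal_weight !cat_rcons /bulk_weight /coin_weight.
by case: t r => [] [] /= h; lra.
Qed.

Lemma left_exchange w r :
  \sum_(b : bool) psi (b :: w) * left_weight p b r = horizontal_weight [::] r w.
Proof.
have [_ left_eq _] := ansatz; have := left_eq w.
rewrite !big_bool /= /horizontal_weight /left_weight /coin_weight.
by case: r => /= h; lra.
Qed.

Lemma right_exchange u t :
  \sum_(h : bool) horizontal_weight u h [::] * right_weight p h t = psi (rcons u t).
Proof.
have [_ _ right_eq] := ansatz; have := right_eq u.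
rewrite !big_bool /= /horizontal_weight !cats1 cats0 /right_weight /coin_weight.
by case: t => /= h; lra.
Qed.

(** Pushing the horizontal letter to the right through the vertices of a row;
    at each step one of the exchange relations sums out the incoming edges. *)
Lemma row_mean_ansatz F k u :
  \sum_(h : bool) sum_words k (fun bs => horizontal_weight u h bs * row_mean p F h bs u) =
  sum_words k.+1 (fun ts => psi (u ++ ts) * F (u ++ ts)).
Proof.
elim: k u => [|k IHk] u.
  rewrite /=; under eq_bigr do rewrite mulr_sumr.
  rewrite exchange_big; apply: eq_bigr => t _.
  under eq_bigr do rewrite mulrA.
  by rewrite -mulr_suml right_exchange cats1.
transitivity (\sum_(t : bool) \sum_(r : bool)
    sum_words k (fun bs =>
      horizontal_weight (rcons u t) r bs * row_mean p F r bs (rcons u t))).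
  rewrite [LHS](_ : _ = \sum_(t : bool) \sum_(r : bool) sum_words k (fun bs =>
    (\sum_(h : bool) \sum_(b : bool) horizontal_weight u h (b :: bs) * bulk_weight p h b t r) *
      row_mean p F r bs (rcons u t))).
    apply: eq_bigr => t _; apply: eq_bigr => r _; apply: eq_sum_words => bs _.
    by rewrite bulk_exchange.
  rewrite !big_bool /= !big_bool /= -!sum_wordsD.
  by apply: eq_sum_words => bs _; rewrite !big_bool /=; ring.
under eq_bigr do rewrite IHk.
rewrite [RHS]/=; apply: eq_bigr => t _; rewrite [LHS]/=; apply: eq_bigr => r _.
by apply: eq_sum_words => ts _; rewrite cat_rcons.
Qed.

Lemma word_mean_ansatz F n :
  sum_words n.+1 (fun w => psi w * word_mean p F w) = sum_words n.+1 (fun w => psi w * F w).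
Proof.
rewrite -[RHS](row_mean_ansatz F n [::]) /= !big_bool /= -!sum_wordsD.
apply: eq_sum_words => bs _; rewrite -!left_exchange.
by rewrite /word_mean !big_bool /=; ring.
Qed.

End MatrixAnsatz.

Section Descent.
Context {R : realFieldType} (p : params R).
Hypothesis rates : stochastic_rates p.

(** Let every vertex send its arrows to the right if there is at most one.  Then
    an arrow reaches the right boundary, where it may leave. *)
Lemma row_mean_descent (h : bool) bs u : (0 < h + count id bs)%N ->
  exists ts, [/\ size ts = (size bs).+1, (count id ts < h + count id bs)%N &
    0 < row_mean p (fun w => (w == u ++ ts)%:R) h bs u].
Proof.
elim: bs h u => [|b bs IHbs] h u /= pos.
  exists [:: false]; split=> //=.
  rewrite big_bool /= !cats1 !eqseq_rcons !eqxx /= mulr0 add0r mulr1.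
  exact: (right_weight_gt0 rates h false).
have [|ts [sz_ts lt_ts mean_gt0]] := IHbs (h || b) (rcons u (h && b)).
  by move: pos; case: h b => [] [].
exists ((h && b) :: ts); split=> /=; first by rewrite sz_ts.
  by move: lt_ts; case: h b {pos mean_gt0} => [] [] /=; lia.
rewrite (bigD1 (h && b)) //= ltr_wpDr //.
  apply: sumr_ge0 => t _; apply: sumr_ge0 => r _.
  by rewrite mulr_ge0 ?bulk_weight_ge0 ?row_mean_ge0 // => w; apply: ler0n.
rewrite (bigD1 (h || b)) //= ltr_wpDr //.
  apply: sumr_ge0 => r _.
  by rewrite mulr_ge0 ?bulk_weight_ge0 ?row_mean_ge0 // => w; apply: ler0n.
rewrite -cat_rcons mulr_gt0 //.
have [_ _ _ _ [/andP[a0 a1] /andP[c0 c1]]] := rates.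
by case: h b {pos lt_ts mean_gt0} => [] []; rewrite /bulk_weight /coin_weight /=; lra.
Qed.

Lemma word_mean_descent w : (0 < count id w)%N ->
  exists ts, [/\ size ts = size w, (count id ts < count id w)%N &
    0 < word_mean p (fun u => (u == ts)%:R) w].
Proof.
case: w => // b bs pos; have [ts [sz_ts lt_ts mean_gt0]] := row_mean_descent [::] pos.
exists ts; split=> //; rewrite /word_mean (bigD1 b) //= ltr_wpDr //.
  apply: sumr_ge0 => r _.
  by rewrite mulr_ge0 ?row_mean_ge0 ?(ltW (left_weight_gt0 rates _ _)) // => u; apply: ler0n.
by rewrite mulr_gt0 // left_weight_gt0.
Qed.

(** The difference of the two normalized stationary measures has total mass 0. *)
Lemma stationary_measure_ansatz (psi : seq bool -> R) n y (mu : n.+1.-tuple bool -> R) :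
  matrix_ansatz p psi -> sum_words n.+1 psi != 0 ->
  stationary_measure p (horizontal_path n.+1 y) mu ->
  forall tau, mu tau = psi tau / sum_words n.+1 psi.
Proof.
move=> ansatz Z_neq0 [[mu_ge0 mu_sum1] muP] tau; apply/eqP; rewrite -subr_eq0; apply/eqP.
set Z := sum_words n.+1 psi in Z_neq0 *.
have trE := @transition_row_mean R p y n.
pose tr (s t : n.+1.-tuple bool) := word_mean p (fun w => (w == t)%:R) s.
apply: (@signed_stationary_eq0 R _ tr [tuple of nseq n.+1 false] (count id)
  _ _ _ (fun t => mu t - psi t / Z)).
- by move=> s t; apply: word_mean_ge0 => // w; apply: ler0n.
- move=> s; rewrite -[RHS](word_mean_cst1 p s) /tr /word_mean exchange_big /=.
  apply: eq_bigr => r _; rewrite -mulr_sumr; congr (_ * _).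
  have sz_s : size (behead s) = n by rewrite size_behead size_tuple.
  have linear h bs u : (size u + size bs = n)%N ->
      \sum_(t : n.+1.-tuple bool) row_mean p (fun w => (w == t)%:R) h bs u =
      row_mean p (fun=> 1) h bs u.
    elim: bs h u => [|b bs IHbs] h u /= sz_u.
      rewrite exchange_big; apply: eq_bigr => t _; rewrite -mulr_sumr; congr (_ * _).
      have sz : size (rcons u t) == n.+1 by rewrite size_rcons -sz_u addn0.
      rewrite (bigD1 (Tuple sz)) //= eqxx big1 ?addr0 // => t' neq_t'.
      by rewrite eq_sym (_ : (_ == _) = false) //; apply/negbTE; move: neq_t'; rewrite -val_eqE.
    rewrite exchange_big; apply: eq_bigr => t _.
    rewrite exchange_big; apply: eq_bigr => r' _; rewrite -mulr_sumr IHbs //.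
    by rewrite size_rcons addSnnS.
  by apply: linear; rewrite sz_s.
- move=> s neq_s; have [|ts [sz_ts lt_ts mean_gt0]] := @word_mean_descent s.
    rewrite lt0n; apply: contra neq_s => /eqP c0; apply/eqP/val_inj => /=.
    have /all_pred1P : all (pred1 false) s.
      by rewrite (@eq_all _ _ (predC id)) ?all_predC ?has_count ?c0 // => -[].
    by rewrite size_tuple.
  have sz : size ts == n.+1 by rewrite sz_ts size_tuple.
  by exists (Tuple sz).
- move=> t; under eq_bigr do rewrite mulrBl.
  rewrite sumrB; congr (_ - _).
    by rewrite -[RHS]muP; apply: eq_bigr => s _; rewrite trE.
  rewrite (sum_words_tuple n.+1 (fun s => psi s / Z * word_mean p (fun w => (w == t)%:R) s)).
  under eq_sum_words => s _ do rewrite mulrAC mulrC.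
  rewrite sum_wordsM word_mean_ansatz // mulrC; congr (_ / _).
  rewrite -(sum_words_tuple n.+1 (fun w => psi w * (w == t)%:R)) (bigD1 t) //= eqxx mulr1.
  rewrite big1 ?addr0 // => s neq_s; rewrite (_ : (_ == _) = false) ?mulr0 //.
  by apply/negbTE; move: neq_s; rewrite -val_eqE.
- rewrite sumrB mu_sum1 (sum_words_tuple n.+1 (fun s => psi s / Z)).
  under eq_sum_words => s _ do rewrite mulrC.
  by rewrite sum_wordsM mulVf // subrr.
Qed.

End Descent.

(** * From ASEP weights to the six-vertex model *)

Section AsepWeights.
Context {R : realFieldType}.

Definition asep_weights (q al be ga de : R) (Phi : seq bool -> R) : Prop :=
  [/\ forall u w, Phi (u ++ [:: true, false & w]) - q * Phi (u ++ [:: false, true & w]) =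
        Phi (u ++ false :: w) + Phi (u ++ true :: w),
      forall w, al * Phi (false :: w) - ga * Phi (true :: w) = Phi w
    & forall w, be * Phi (rcons w true) - de * Phi (rcons w false) = Phi w].

Definition partition_fun (Phi : seq bool -> R) (N : nat) (y : R) : R :=
  sum_words N (fun w => y ^+ count id w * Phi w).

Lemma asep_weights_poly (q al be ga de : R) (phi : {poly R} -> R) :
  0 < al ->
  linear_form phi ->
  (forall f, be * phi ('X * f) = de * phi (hole q al ga f) + phi f) ->
  asep_weights q al be ga de (fun w => phi (act q al ga w 1)).
Proof.
move=> al_gt0 phiP phiX.
have actP w c f g : act q al ga w (c *: f + g) = c *: act q al ga w f + act q al ga w g.
  elim: w f g => //= b w IHw f g; rewrite -IHw; congr (act _ _ _ w _).
  case: b => /=; first by rewrite mulrDr scalerAr.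
  exact: linearP.
split=> [u w|w|w].
- rewrite /act !foldl_cat /= -/(act q al ga w _) -/(act q al ga u 1).
  set f := act q al ga u 1; rewrite holeX.
  have -> : (q *: 'X + 1) * hole q al ga f + 'X * f =
    q *: ('X * hole q al ga f) + (1 *: hole q al ga f + 'X * f).
    by rewrite mulrDl mul1r scale1r -scalerAl addrA.
  by rewrite -!/(act q al ga w _) !actP !phiP mul1r addrAC subrr add0r.
- rewrite /act /= mulr1 hole1 -!/(act q al ga w _).
  have -> : (ga / al) *: 'X + (al^-1)%:P = (ga / al) *: 'X + (al^-1 *: 1 + 0) :> {poly R}.
    by rewrite addr0 alg_polyC.
  have phi0' : phi (act q al ga w 0) = 0.
    have := actP w (-1) 0 0; rewrite scaler0 addr0 => ->.
    by rewrite phiP mulN1r addNr.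
  have al_neq0 : al != 0 by rewrite gt_eqF.
  rewrite !actP !phiP phi0' addr0.
  by move: (phi _) (phi _) => a b; field.
- by rewrite /act !foldl_rcons /= phiX addrC addKr.
Qed.

(** Particle-hole symmetry combined with reflection preserves the bulk relation
    and exchanges the two ends. *)
Lemma asep_weights_reverse (q al be ga de : R) Phi :
  asep_weights q be al de ga Phi ->
  asep_weights q al be ga de (fun w => Phi (rev (map negb w))).
Proof.
move=> [bulk left right]; split=> [u w|w|w].
- rewrite !map_cat /= !rev_cat !rev_cons -!cats1 -!catA /=.
  by rewrite bulk addrC.
- by rewrite /= !rev_cons right.
- by rewrite !map_rcons !rev_rcons left.
Qed.

Lemma partition_fun_reverse Phi N (y : R) : y != 0 ->
  partition_fun (fun w => Phi (rev (map negb w))) N y = y ^+ N * partition_fun Phi N y^-1.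
Proof.
move=> y_neq0; rewrite /partition_fun -sum_wordsM.
rewrite -[RHS]sum_words_rev -[RHS]sum_words_map_negb; apply: eq_sum_words => w sz_w.
rewrite count_rev count_map mulrA; congr (_ * _).
have -> : N = (count id w + count (predC id) w)%N by rewrite count_predC sz_w.
by rewrite exprD -mulrA -exprMn mulfV // expr1n mulr1.
Qed.

(** The factor [r] per particle makes the coefficients of the two linear terms of
    the bulk relation equal, and the common factor [k] normalizes them to 1. *)
Lemma matrix_ansatz_asep (p : params R) Phi :
  0 < theta1 p < 1 -> 0 < theta2 p < 1 -> par_b p + par_d p < 1 ->
  asep_weights (theta1 p / theta2 p)
    ((1 - theta1 p) * par_a p / theta2 p)
    ((1 - theta2 p) * par_b p / (theta2 p * (1 - par_b p - par_d p)))
    ((1 - theta2 p) * par_c p / theta2 p)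
    ((1 - theta1 p) * par_d p / (theta2 p * (1 - par_b p - par_d p))) Phi ->
  matrix_ansatz p (fun w => ((1 - theta1 p) / theta2 p) ^+ size w *
    (((1 - theta2 p) / (1 - theta1 p)) ^+ count id w * Phi w)).
Proof.
move=> /andP[t1_gt0 t1_lt1] /andP[t2_gt0 t2_lt1] hbd [bulk left right].
have d1 : 1 - theta1 p != 0 by rewrite gt_eqF // subr_gt0.
have d2 : theta2 p != 0 by rewrite gt_eqF.
have d3 : 1 - par_b p - par_d p != 0 by rewrite gt_eqF //; lra.
set k := (1 - theta1 p) / theta2 p; set r := (1 - theta2 p) / (1 - theta1 p).
pose psi w := k ^+ size w * (r ^+ count id w * Phi w).
have psiE u v w : psi (u ++ v ++ w) = k ^+ size (u ++ w) * r ^+ count id (u ++ w) *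
    (k ^+ size v * r ^+ count id v * Phi (u ++ v ++ w)).
  rewrite /psi !size_cat !count_cat addnCA [(count id u + _)%N]addnCA !exprD; ring.
split=> [u w|w|w]; rewrite -!/(psi _).
- have h := bulk u w.
  rewrite (psiE u [:: true; false]) (psiE u [:: false; true]).
  rewrite (psiE u [:: false]) (psiE u [:: true]).
  set E := k ^+ size (u ++ w) * r ^+ count id (u ++ w); rewrite /= !expr1 expr0 !mulr1.
  transitivity (E * (theta2 p * k ^+ 2 * r * (Phi (u ++ false :: w) + Phi (u ++ true :: w)))).
    by rewrite -h; field.
  by rewrite /k /r; field; rewrite d1 d2.
- have h := left w.
  rewrite /psi /= add0n add1n !exprS -h.
  move: (k ^+ size w) (r ^+ count id w) => K C.
  by rewrite /k /r; field; rewrite d1 d2.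
- have := right w; rewrite /psi !size_rcons -!cats1 !count_cat /= !addn0 addn1 !exprS.
  move=> <-; move: (k ^+ size w) (r ^+ count id w) => K C.
  by rewrite /k /r; field; rewrite d1 d2 d3.
Qed.

End AsepWeights.

(** * The limit of the density *)

Section Density.
Context {R : realType}.

Lemma expR_le_quadratic (h : R) : h <= 2^-1 -> expR h - 1 <= h + 2 * h ^+ 2.
Proof.
move=> h_le; have h_lt1 : 0 < 1 - h by lra.
have : (1 - h) * expR h <= 1.
  rewrite -[leRHS](expRxMexpNx_1 h) mulrC ler_pM2l ?expR_gt0 //.
  exact: expR_ge1Dx.
rewrite -ler_pdivlMl // => /le_trans le_e; rewrite lerBlDr; apply: le_e.
rewrite mulr1 -[leLHS]mulr1 ler_pdivrMl //.
have : 0 <= h ^+ 2 * (1 - 2 * h) by rewrite mulr_ge0 ?sqr_ge0 //; lra.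
lra.
Qed.

Lemma mean_density_count N (mu : N.-tuple bool -> R) : (0 < N)%N ->
  N%:R * finite_mean mu (@mean_density R N) = \sum_tau mu tau * (count id tau)%:R.
Proof.
move=> N_gt0; rewrite /finite_mean mulr_sumr; apply: eq_bigr => tau _.
rewrite mulrCA /mean_density mulVKf ?pnatr_eq0 ?gt_eqF //; congr (_ * _).
rewrite -natr_sum; congr _%:R.
rewrite -(big_tuple _ _ tau xpredT (fun b : bool => nat_of_bool b)).
by elim: (tval tau) => [|b s IHs] /=; rewrite ?big_nil // big_cons IHs.
Qed.

(** Jensen's inequality, from the tangent line of the exponential at the mean. *)
Lemma exp_moment_ge (T : finType) (mu : T -> R) (K : T -> R) :
  is_distribution mu ->
  expR (\sum_t mu t * K t) <= \sum_t mu t * expR (K t).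
Proof.
move=> [mu_ge0 mu_sum1]; set m := \sum_t mu t * K t.
have -> : expR m = \sum_t mu t * (expR m * (1 + (K t - m))).
  have -> : \sum_t mu t * (expR m * (1 + (K t - m))) =
      expR m * (\sum_t mu t * K t + (1 - m) * \sum_t mu t).
    rewrite mulr_sumr -big_split mulr_sumr /=.
    by apply: eq_bigr => t _; ring.
  by rewrite mu_sum1 -/m; ring.
apply: ler_sum => t _; apply: ler_wpM2l => //.
rewrite -[in leRHS](subrKC m (K t)) expRD; apply: ler_wpM2l; first exact: expR_ge0.
exact: expR_ge1Dx.
Qed.

Section Limit.
Variables (q x v : R) (Phi : seq bool -> R) (mu : forall N, N.-tuple bool -> R).
Hypotheses (q_lt1 : q < 1) (x_gt0 : 0 < x) (v_gt0 : 0 < v).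
Hypothesis upper : forall (y : R) N, 0 < y -> partition_fun Phi N y <= growth q v y ^+ N.
Hypothesis lower : forall L : R, 0 <= L -> L < growth q v x ->
  exists (c : R) k, 0 < c /\ forall N, c * L ^+ N <= partition_fun Phi (k + N) x.
Hypothesis mu_dist : forall N, (0 < N)%N -> is_distribution (@mu N).
Hypothesis mu_Phi : forall N, (0 < N)%N -> partition_fun Phi N x != 0 ->
  forall tau : N.-tuple bool, mu tau = x ^+ count id tau * Phi tau / partition_fun Phi N x.

Let rho := x / (v + x).
Let m N := finite_mean (@mu N) (@mean_density R N).

(** [exp (h N m)] is at most the exponential moment [Z (x e^h) / Z x], whose
    exponential rate is at most [ln (1 + rho (e^h - 1)) <= rho (e^h - 1)].  The
    sign of [h] decides whether this bounds [m] from above or from below. *)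
Lemma density_one_sided (h e : R) : h <= 2^-1 -> 0 < e ->
  exists N0, forall N, (N0 <= N)%N -> h * m N <= rho * (h + 2 * h ^+ 2) + 2 * e.
Proof.
move=> h_le e_gt0; have G_gt0 := growth_gt0 q_lt1 v_gt0 x_gt0.
have [G GE] : exists G, G = growth q v x by exists (growth q v x).
have lower' := lower; rewrite -GE in G_gt0 lower'.
have L_ge0 : 0 <= G * expR (- e) by rewrite mulr_ge0 ?expR_ge0 // ltW.
have L_lt : G * expR (- e) < G by rewrite gtr_pMr // expR_lt1 oppr_lt0.
have [c [k [c_gt0 le_Z]]] := lower' _ L_ge0 L_lt.
pose A := G ^+ k / c; have A_gt0 : 0 < A by rewrite divr_gt0 ?exprn_gt0.
pose kap := ln A.
have [N1 N1_ge] : exists N1 : nat, kap / e <= N1%:R.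
  by exists (Num.bound `|kap / e|); apply/(le_trans (ler_norm _))/ltW/archi_boundP.
have rho_gt0 : 0 < rho by rewrite divr_gt0 ?addr_gt0.
have xe_gt0 : 0 < x * expR h by rewrite mulr_gt0 ?expR_gt0.
have Gh : growth q v (x * expR h) <= G * expR (rho * (expR h - 1)).
  have -> : growth q v (x * expR h) = G * (1 + rho * (expR h - 1)).
    rewrite GE /growth /rho; field.
    have -> : v != 0 by rewrite gt_eqF.
    have -> : 1 - q != 0 by rewrite gt_eqF // subr_gt0.
    have vx : v + x != 0 by rewrite gt_eqF // addr_gt0.
    by rewrite vx.
  by apply: ler_wpM2l; [exact: ltW | exact: expR_ge1Dx].
exists (k + N1.+1)%N => N le_N; have N_gt0 : (0 < N)%N by apply: leq_trans le_N; rewrite addnS.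
have NR_gt0 : 0 < N%:R :> R by rewrite ltr0n.
have kN : N = (k + (N - k))%N by rewrite subnKC // (leq_trans (leq_addr _ _) le_N).
have Z_ge : G ^+ N * expR (- (N%:R * e)) <= A * partition_fun Phi N x.
  have := le_Z (N - k)%N; rewrite -kN.
  rewrite -(ler_pM2l A_gt0); apply: le_trans.
  have -> (X : R) : A * (c * X) = G ^+ k * X by rewrite /A; field; rewrite gt_eqF.
  rewrite exprMn mulrA -exprD -kN.
  rewrite ler_pM2l ?exprn_gt0 // -expRM_natl ler_expR mulrN lerN2 ler_pM2r //.
  by rewrite ler_nat leq_subr.
have Z_gt0 : 0 < partition_fun Phi N x.
  rewrite -(pmulr_rgt0 _ A_gt0); apply: lt_le_trans Z_ge.
  by rewrite mulr_gt0 ?exprn_gt0 ?expR_gt0.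
have muE := mu_Phi N_gt0 (lt0r_neq0 Z_gt0).
have moment : expR (h * (N%:R * m N)) * partition_fun Phi N x <=
    partition_fun Phi N (x * expR h).
  rewrite mean_density_count // mulr_sumr -ler_pdivlMr //.
  have -> : \sum_(tau : N.-tuple bool) h * (mu tau * (count id tau)%:R) =
     \sum_(tau : N.-tuple bool) mu tau * (h * (count id tau)%:R).
    by apply: eq_bigr => t _; rewrite mulrCA.
  apply: le_trans (exp_moment_ge _ (mu_dist N_gt0)) _.
  rewrite [partition_fun Phi N (x * expR h)]/partition_fun -sum_words_tuple mulr_suml.
  rewrite le_eqVlt; apply/orP; left; apply/eqP; apply: eq_bigr => t _.
  by rewrite muE [h * _]mulrC expRM_natl exprMn; ring.
have bound : expR (h * (N%:R * m N)) * (G ^+ N * expR (- (N%:R * e))) <=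
    A * (G * expR (rho * (expR h - 1))) ^+ N.
  apply: le_trans (ler_wpM2l (expR_ge0 _) Z_ge) _.
  rewrite mulrCA ler_pM2l //; apply: (le_trans moment); apply: (le_trans (upper N xe_gt0)).
  by apply: lerXn2r => //; rewrite nnegrE ?ltW ?growth_gt0 // mulr_gt0 ?expR_gt0.
move: bound; rewrite exprMn mulrCA [A * _]mulrCA ler_pM2l ?exprn_gt0 //.
rewrite -expRM_natl -expRD -[A]lnK ?posrE // -/kap -expRD ler_expR => bound.
have kap_le : kap <= N%:R * e.
  rewrite -ler_pdivrMr //; apply: (le_trans N1_ge); rewrite ler_nat.
  by apply: leq_trans le_N; rewrite addnS leqW // leq_addl.
have quad := ler_wpM2l (ltW rho_gt0) (expR_le_quadratic h_le).
rewrite -(ler_pM2l NR_gt0).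
have := ler_wpM2l (ltW NR_gt0) quad; lra.
Qed.

Lemma density_limit : ((fun N => m N) @ \oo --> rho)%classic.
Proof.
apply/cvgrPdist_le => e e_gt0.
have rho_gt0 : 0 < rho by rewrite divr_gt0 ?addr_gt0.
have rho_le1 : rho <= 1 by rewrite ler_pdivrMr ?addr_gt0 // mul1r lerDr ltW.
(* with [h = s] or [h = - s] and an error [s ^+ 2] both bounds are within [4 s] *)
pose s := Num.min 2^-1 (e / 4).
have s_gt0 : 0 < s by rewrite lt_min invr_gt0 ltr0n divr_gt0.
have s_le : s <= 2^-1 by rewrite ge_min lexx.
have s_e : 4 * s <= e.
  have : s <= e / 4 by rewrite ge_min lexx orbT.
  lra.
have s2_gt0 : 0 < s ^+ 2 by rewrite exprn_gt0.
have sN_le : - s <= 2^-1 by lra.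
have [N1 le1] := density_one_sided s_le s2_gt0.
have [N2 le2] := density_one_sided sN_le s2_gt0.
exists (maxn N1 N2) => // N /=; rewrite geq_max => /andP[/le1 h1 /le2 h2].
have rs : rho * (s * s) <= s * s by rewrite ler_piMl // mulr_ge0 // ltW.
rewrite sqrrN in h2.
have m_le : m N - rho <= 4 * s.
  by rewrite -(ler_pM2l s_gt0); lra.
have m_ge : rho - m N <= 4 * s.
  by rewrite -(ler_pM2l s_gt0); lra.
rewrite ler_norml; apply/andP; split; lra.
Qed.

End Limit.
End Density.

(** * The phase diagram *)

Section Kappa.
Context {R : realType}.

(** [kappa_plus q u w] is the positive root of
    [u t ^+ 2 - (1 - q - u + w) t - w], that is, of
    [(u t - w) (1 + t) - (1 - q) t]. *)
Lemma kappa_plusP (q u w : R) : q < 1 -> 0 < u -> 0 < w ->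
  let k := kappa_plus q u w in
  [/\ 0 < k, (u * k - w) * (1 + k) = (1 - q) * k
    & forall t, k <= t -> (1 - q) * t <= (u * t - w) * (1 + t)].
Proof.
move=> q_lt1 u_gt0 w_gt0 k.
pose B := 1 - q - u + w; pose D := Num.sqrt (B ^+ 2 + 4 * u * w).
have uw_gt0 : 0 < u * w by rewrite mulr_gt0.
have disc_ge0 : 0 <= B ^+ 2 + 4 * u * w.
  by rewrite addr_ge0 ?sqr_ge0 // -mulrA mulr_ge0 // ltW.
have D2 : D ^+ 2 = B ^+ 2 + 4 * u * w by rewrite sqr_sqrtr.
have D_ge0 : 0 <= D by exact: sqrtr_ge0.
have kE : 2 * u * k = B + D.
  by rewrite /k /kappa_plus mulrA mulfV ?mul1r // mulf_neq0 ?gt_eqF.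
have D_gt : `|B| < D.
  rewrite -(ltr_pXn2r (n := 2)) ?nnegrE // D2 real_normK ?num_real //.
  by rewrite ltrDl -mulrA mulr_gt0.
have BD : 0 < B + D by have := ler_norm (- B); rewrite normrN; lra.
have k_gt0 : 0 < k.
  have : 0 < 2 * u * k by rewrite kE.
  by rewrite pmulr_rgt0 // mulr_gt0.
have kD : 2 * u * k - B = D by rewrite kE addrC addKr.
have root : (u * k - w) * (1 + k) = (1 - q) * k.
  apply: (mulfI (lt0r_neq0 (_ : 0 < 4 * u))); first by rewrite mulr_gt0.
  have : (2 * u * k - B) ^+ 2 = B ^+ 2 + 4 * u * w by rewrite kD D2.
  by rewrite /B; lra.
split=> // t le_kt.
(* the difference of the two sides is [(t - k) * (u * (t + k) - B)] *)
have : 0 <= (t - k) * (u * (t + k) - B).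
  rewrite mulr_ge0 ?subr_ge0 //.
  have := ler_wpM2l (ltW u_gt0) le_kt; lra.
by rewrite /B; lra.
Qed.

End Kappa.

Section Phases.
Context {R : realType} (q al be ga de : R).
Hypotheses (q_gt0 : 0 < q) (q_lt1 : q < 1).
Hypotheses (al_gt0 : 0 < al) (be_gt0 : 0 < be) (ga_gt0 : 0 < ga) (de_gt0 : 0 < de).
Let A := kappa_plus q be de.
Let C := kappa_plus q al ga.
Hypothesis AC_lt1 : A * C < 1.

(** The equation of a root gives [gamma < alpha * C] and [delta < beta * A]. *)
Lemma fan_region : ga * de < al * be.
Proof.
have [C_gt0 C_root _] := kappa_plusP q_lt1 al_gt0 ga_gt0.
have [A_gt0 A_root _] := kappa_plusP q_lt1 be_gt0 de_gt0.
rewrite -/A -/C in C_gt0 C_root A_gt0 A_root.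
have q1 : 0 < 1 - q by rewrite subr_gt0.
have gaC : ga < al * C.
  have C1 : 0 < 1 + C by rewrite addr_gt0.
  have : 0 < (al * C - ga) * (1 + C) by rewrite C_root mulr_gt0.
  by rewrite (pmulr_lgt0 _ C1) subr_gt0.
have deA : de < be * A.
  have A1 : 0 < 1 + A by rewrite addr_gt0.
  have : 0 < (be * A - de) * (1 + A) by rewrite A_root mulr_gt0.
  by rewrite (pmulr_lgt0 _ A1) subr_gt0.
apply: (@lt_trans _ _ (al * C * (be * A))).
  by apply: ltr_pM => //; apply: ltW.
have -> : al * C * (be * A) = al * be * (A * C) by ring.
by rewrite gtr_pMr // mulr_gt0.
Qed.

(** ASEP weights whose partition function grows like [growth q v]: at most so
    for all [y], and exactly so, exponentially, at [y = x]. *)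
Definition growth_weights (x v : R) (Phi : seq bool -> R) : Prop :=
  [/\ asep_weights q al be ga de Phi,
      forall (y : R) N, 0 < y -> partition_fun Phi N y <= growth q v y ^+ N
    & forall L : R, 0 <= L -> L < growth q v x ->
      exists (c : R) k, 0 < c /\ forall N, c * L ^+ N <= partition_fun Phi (k + N) x].

(** The bounds [C <= v] and [A <= 1 / v] are what the upper bound asks for at the
    left and right end. *)
Lemma growth_weights_exist (x v : R) : 0 < x -> 0 < v -> C <= v -> A * v <= 1 ->
  (C = v /\ x < v ^+ 2) \/ x = v ^+ 2 ->
  exists Phi, growth_weights x v Phi.
Proof.
move=> x_gt0 v_gt0 le_Cv le_Av phase.
have [C_gt0 C_root C_above] := kappa_plusP q_lt1 al_gt0 ga_gt0.
have [A_gt0 A_root A_above] := kappa_plusP q_lt1 be_gt0 de_gt0.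
rewrite -/A -/C in C_gt0 C_root A_gt0 A_root C_above A_above.
have [phi [phiP phi1 phi_ge0 phiX]] := ansatz_functional_exists (ltW q_gt0) q_lt1 al_gt0
  (ltW ga_gt0) (ltW de_gt0) fan_region.
exists (fun w => phi (act q al ga w 1)); split.
- exact: asep_weights_poly.
- move=> y N y_gt0.
  apply: (partition_fun_upper (ltW q_gt0) q_lt1 al_gt0 (ltW ga_gt0) (ltW de_gt0)
    fan_region) => //.
  + exact: C_above.
  have le_Av' : A <= v^-1 by rewrite -[v^-1]mul1r ler_pdivlMr.
  have v2_gt0 : 0 < v ^+ 2 by rewrite exprn_gt0.
  have := A_above _ le_Av'; rewrite -(ler_pM2l v2_gt0).
  have v_neq0 : v != 0 by rewrite gt_eqF.
  have -> : v ^+ 2 * ((1 - q) / v) = (1 - q) * v by field.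
  by have -> : v ^+ 2 * ((be / v - de) * (1 + v^-1)) = (be - de * v) * (1 + v) by field.
move=> L L_ge0 L_lt.
have n1 : nncoef (1 : {poly R}) by rewrite -(expr0 'X); apply: nncoefXn.
have [c [k [c_gt0 le_c]]] : exists c k, 0 < c /\
    forall N, c * L ^+ N <= (iter (k + N) (transfer q al ga x) 1).[0].
  case: phase => [[Cv x_lt]|xE].
    by apply: (low_density_lower_bound _ _ _ _ _ v_gt0 _ x_lt) => //; rewrite -?Cv // ltW.
  by apply: (max_current_lower_bound _ _ _ _ _ v_gt0 xE) => //; apply: ltW.
exists c, k; split=> // N; apply: (le_trans (le_c N)).
rewrite /partition_fun (sum_words_transfer _ _ _ phiP); apply: coef0_le_functional => //.
by apply: nncoef_iter_transfer => //; apply: ltW.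
Qed.

End Phases.

Lemma growth_weights_reverse (R : realType) (q al be ga de x v : R) Phi :
  q < 1 -> 0 < x -> 0 < v -> growth_weights q be al de ga x^-1 v^-1 Phi ->
  growth_weights q al be ga de x v (fun w => Phi (rev (map negb w))).
Proof.
move=> q_lt1 x_gt0 v_gt0 [weights upper lower].
have v_neq0 : v != 0 by rewrite gt_eqF.
have q_neq1 : 1 - q != 0 by rewrite gt_eqF // subr_gt0.
have growthV y : 0 < y -> growth q v y = y * growth q v^-1 y^-1.
  by move=> y_gt0; rewrite /growth; field; rewrite q_neq1 v_neq0 gt_eqF.
split; first exact: asep_weights_reverse.
  move=> y N y_gt0; rewrite partition_fun_reverse ?gt_eqF // growthV // exprMn.
  by rewrite ler_pM2l ?exprn_gt0 // upper // invr_gt0.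
move=> L L_ge0; rewrite growthV // -ltr_pdivrMl // => L_lt.
have L_ge0' : 0 <= x^-1 * L by rewrite mulr_ge0 // invr_ge0 ltW.
have [c [k [c_gt0 le_c]]] := lower _ L_ge0' L_lt.
exists (c * x ^+ k), k; split; first by rewrite mulr_gt0 ?exprn_gt0.
move=> N; rewrite partition_fun_reverse ?gt_eqF //.
have := le_c N; rewrite -(ler_pM2l (exprn_gt0 (k + N) x_gt0)); apply: le_trans.
rewrite exprD exprMn exprVn le_eqVlt; apply/orP; left; apply/eqP.
by field; rewrite expf_neq0 // gt_eqF.
Qed.

Theorem theorem1p2 (R : realType) (a b c d th1 th2 : R)
    (ha : 0 < a < 1) (hb : 0 < b < 1) (hc : 0 < c < 1) (hd : 0 < d < 1)
    (hth1 : 0 < th1 < 1) (hth2 : 0 < th2 < 1)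
    (hth : th1 < th2) (hbd : b + d < 1) :
  let p := Params a b c d th1 th2 in
  forall (y : nat) (mu : forall N : nat, N.-tuple bool -> R),
  (forall N : nat, (1 <= N)%N ->
     stationary_measure p (horizontal_path N y) (mu N)) ->
  par_A p * par_C p < 1 ->
  (technical_condition p ->
     phase_limit p (fun N => finite_mean (mu N) (@mean_density R N))) /\
  (a + c < 1 ->
     phase_limit p (fun N => finite_mean (mu N) (@mean_density R N))).
Proof.
move=> p y mu mu_stat AC_lt1.
suff phases : phase_limit p (fun N => finite_mean (mu N) (@mean_density R N)) by [].
have [[a0 a1] [b0 b1] [c0 c1] [d0 d1]] :
  [/\ 0 < a /\ a < 1, 0 < b /\ b < 1, 0 < c /\ c < 1 & 0 < d /\ d < 1].
  by split; apply/andP.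
have [[t10 t11] [t20 t21]] : (0 < th1 /\ th1 < 1) /\ (0 < th2 /\ th2 < 1).
  by split; apply/andP.
have e1 : 0 < 1 - th1 by rewrite subr_gt0.
have e2 : 0 < 1 - th2 by rewrite subr_gt0.
have e3 : 0 < 1 - b - d by lra.
have rates : stochastic_rates p by split.
pose q := par_q p; pose r := par_r p.
pose al := par_alpha p; pose be := par_beta p.
pose ga := par_gamma p; pose de := par_delta p.
have q_gt0 : 0 < q by rewrite divr_gt0.
have q_lt1 : q < 1 by rewrite ltr_pdivrMr // mul1r.
have r_gt0 : 0 < r by rewrite divr_gt0.
have al_gt0 : 0 < al by rewrite divr_gt0 ?mulr_gt0.
have be_gt0 : 0 < be by rewrite divr_gt0 ?mulr_gt0.
have ga_gt0 : 0 < ga by rewrite divr_gt0 ?mulr_gt0.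
have de_gt0 : 0 < de by rewrite divr_gt0 ?mulr_gt0.
have [C_gt0 _ _] := kappa_plusP q_lt1 al_gt0 ga_gt0.
have [A_gt0 _ _] := kappa_plusP q_lt1 be_gt0 de_gt0.
rewrite -/(par_A p) -/(par_C p) in A_gt0 C_gt0.
have limit v Phi : 0 < v -> growth_weights q al be ga de r v Phi ->
    ((fun N => finite_mean (mu N) (@mean_density R N)) @ \oo --> r / (v + r))%classic.
  move=> v_gt0 [weights upper lower].
  apply: (@density_limit R q r v Phi (fun N => mu N)) => //.
    by move=> N /mu_stat[].
  case=> // n _ Z_neq0 tau.
  have ansatz : matrix_ansatz p (fun w => ((1 - th1) / th2) ^+ size w *
      (r ^+ count id w * Phi w)) by apply: matrix_ansatz_asep.
  set k := (1 - th1) / th2 in ansatz; have k_gt0 : 0 < k by rewrite divr_gt0.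
  have ZE : sum_words n.+1 (fun w => k ^+ size w * (r ^+ count id w * Phi w)) =
      k ^+ n.+1 * partition_fun Phi n.+1 r.
    by rewrite -sum_wordsM; apply: eq_sum_words => w ->.
  have kn_neq0 : k ^+ n.+1 != 0 by rewrite expf_neq0 // gt_eqF.
  rewrite (stationary_measure_ansatz rates ansatz _ (mu_stat n.+1 isT)) ZE ?mulf_neq0 //.
  by rewrite size_tuple; field; rewrite kn_neq0 andbT.
pose s := Num.sqrt r.
have s_gt0 : 0 < s by rewrite sqrtr_gt0.
have s2 : r = s ^+ 2 by rewrite sqr_sqrtr // ltW.
have s_neq0 : s != 0 by rewrite gt_eqF.
rewrite /phase_limit -/r -/s; split.
- move=> [A_le C_le].
  have [Phi Phi_w] : exists Phi, growth_weights q al be ga de r s Phi.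
    apply: growth_weights_exist => //; last by right.
    by rewrite -ler_pdivlMr // mul1r.
  have -> : s / (1 + s) = r / (s + r).
    by rewrite s2; field; rewrite ?gt_eqF ?addr_gt0 ?exprn_gt0.
  exact: limit Phi_w.
- move=> [A_gt _].
  (* the holes, seen from the other end, are in the low density phase *)
  have [Phi Phi_w] : exists Phi, growth_weights q be al de ga r^-1 (par_A p) Phi.
    apply: growth_weights_exist; rewrite ?invr_gt0 //.
    + by rewrite mulrC.
    + by rewrite mulrC ltW.
    left; split=> //; rewrite s2 -exprVn ltr_pXn2r ?nnegrE ?invr_ge0 ?ltW //.
  have -> : par_A p * r / (1 + par_A p * r) = r / ((par_A p)^-1 + r).
    have Ar_neq0 : 1 + par_A p * r != 0 by rewrite gt_eqF // addr_gt0 // mulr_gt0.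
    have A_neq0 : par_A p != 0 by rewrite gt_eqF.
    by move: (par_A p) Ar_neq0 A_neq0 => A Ar_neq0 A_neq0; field; rewrite A_neq0 [r * A]mulrC.
  have v_gt0 : 0 < (par_A p)^-1 by rewrite invr_gt0.
  apply: (limit (par_A p)^-1 (fun w => Phi (rev (map negb w)))) => //.
  by apply: growth_weights_reverse => //; rewrite invrK.
- move=> [C_gt _].
  have [Phi Phi_w] : exists Phi, growth_weights q al be ga de r (par_C p) Phi.
    apply: growth_weights_exist => //; first exact: ltW.
    by left; split=> //; rewrite s2 ltr_pXn2r ?nnegrE ?ltW.
  rewrite [r + _]addrC; exact: limit Phi_w.
Qed.
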